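(* Let $m$ be an odd positive integer, $k\ge0$ an integer, $N=k+\frac{m-1}{2}$, and let $P_k(\underline x)$ be an $\mathbb R_{0,m}$-valued homogeneous polynomial of degree $k$ on $\mathbb R^m$ with $\partial_{\underline x}P_k=0$. Then a closed formula for the Cauchy–Kowalevski extension of $\exp(-|\underline x|^2)P_k(\underline x)$ is \begin{multline*} \mathsf{CK}\left[\exp\left(-|\underline x|^2\right)P_k(\underline x)\right](x_0,\underline x)=\frac{\mathsf{Ft}\left[\exp(z^2),P_k(\underline x)\right](x_0,\underline x)}{(-2)^{N}(2k+m-1)!!}\\ =\exp\left(x_0^2-r^2\right)\left(\sum_{j=0}^{N}\binom{N}{j}(-2)^{-j}D_r(j)[\cos(2x_0r)]+\underline\omega\sum_{j=0}^{N}\binom{N}{j}(-2)^{-j}D^r(j)[\sin(2x_0r)]\right)P_k(\underline x). \end{multline*}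
   Context: $\mathbb R_{0,m}$ is the real Clifford algebra generated by $e_1,\dots,e_m$ with $e_je_k+e_ke_j=-2\delta_{jk}$; $\underline x\in\mathbb R^m$ is identified with $\sum_j x_je_j$. Write $r=|\underline x|$, $\underline\omega=\underline x/r$; points of $\mathbb R^{m+1}$ are $(x_0,\underline x)$. Dirac operator $\partial_{\underline x}=\sum_{j=1}^m e_j\partial_{x_j}$; a $C^1$ $\mathbb R_{0,m}$-valued function $f$ on an open subset of $\mathbb R^{m+1}$ is monogenic if $(\partial_{x_0}+\partial_{\underline x})f=0$. For $g$ real-analytic and $\mathbb R_{0,m}$-valued on an open $\underline\Omega\subset\mathbb R^m$, $\mathsf{CK}[g](x_0,\underline x)=\sum_{n\ge0}\frac{(-x_0)^n}{n!}\partial_{\underline x}^ng(\underline x)$ is its unique monogenic extension to a neighbourhood of $\underline\Omega$ in $\mathbb R^{m+1}$. Fueter map: for $h(z)=u(x,y)+iv(x,y)$ holomorphic on an open subset $\Xi$ of the upper half plane, $\mathsf{Ft}[h(z),P_k(\underline x)](x_0,\underline x)=\Delta^{k+\frac{m-1}{2}}[(u(x_0,r)+\underline\omega\,v(x_0,r))P_k(\underline x)]$ with $\Delta=\sum_{j=0}^m\partial_{x_j}^2$, defined where $(x_0,r)\in\Xi$. The operators in the variable $r>0$ are $D_r(n)[f]=(r^{-1}\partial_r)^nf$ and $D^r(n)[f]=(\partial_r\circ r^{-1})^nf$ (i.e. $n$-fold application of $f\mapsto\partial_r(f/r)$), with $D_r(0)=D^r(0)=\mathrm{id}$. Double factorials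 use $(-1)!!=0!!=1$. *)

(* Defs.v *)
From HB Require Import structures.
From mathcomp Require Import all_boot all_order all_algebra.
From mathcomp Require Import all_classical all_reals all_analysis.
Set Implicit Arguments. Unset Strict Implicit. Unset Printing Implicit Defensive.
Import Order.TTheory GRing.Theory Num.Theory.
Import numFieldNormedType.Exports.
Local Open Scope ring_scope.
Local Open Scope classical_set_scope.

Section Clifford.
Variable R : realType.
Variable m : nat.

(* The real Clifford algebra R_{0,m}: an element is the family of its
   coordinates on the basis e_A, A ranging over subsets of {1..m}
   (here 'I_m), e_A = e_{a1} ... e_{ap} with a1 < ... < ap. *)
Definition clif := {ffun {set 'I_m} -> R}.

Definition cbasis (A : {set 'I_m}) : clif := [ffun D => (D == A)%:R].
Definition cone1 : clif := cbasis (finset.set0 : {set 'I_m}).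

(* e_A e_B = csign A B * e_{A csymdiff B}, using e_j e_k + e_k e_j = -2 delta_jk *)
Definition csign (A B : {set 'I_m}) : R :=
  (-1) ^+ (#|(finset (fun p : 'I_m * 'I_m => (p.1 \in A) && (p.2 \in B) && (p.2 < p.1)%N))|
           + #|A :&: B|)%N.

Definition csymdiff (A B : {set 'I_m}) := (A :\: B) :|: (B :\: A).

Definition cmul (a b : clif) : clif :=
  \sum_(A : {set 'I_m}) \sum_(B : {set 'I_m})
     (a A * b B * csign A B) *: cbasis (csymdiff A B).

Definition vec := 'rV[R]_m.
Definition xcoord (x : vec) (j : 'I_m) : R := x ord0 j.
Definition unitv (j : 'I_m) : vec := delta_mx ord0 j.
Definition rnorm (x : vec) : R := Num.sqrt (\sum_j xcoord x j ^+ 2).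
Definition cvec (x : vec) : clif := \sum_j xcoord x j *: cbasis [set j].
Definition comega (x : vec) : clif := (rnorm x)^-1 *: cvec x.

Definition cpartial (j : 'I_m) (g : vec -> clif) : vec -> clif :=
  fun x => [ffun A => derive1 (fun t : R => g (x + t *: unitv j) A) 0].

Definition Dirac (g : vec -> clif) : vec -> clif :=
  fun x => \sum_j cmul (cbasis [set j]) (cpartial j g x).

Definition lapl (F : R -> vec -> clif) : R -> vec -> clif :=
  fun x0 x => [ffun A =>
     derive1 (derive1 (fun t : R => F t x A)) x0
   + \sum_j derive1 (derive1 (fun t : R => F x0 (x + t *: unitv j) A)) 0].

Definition ck_psum (g : vec -> clif) (x0 : R) (x : vec) (n : nat) : clif :=
  \sum_(i < n) ((- x0) ^+ i / (i`!)%:R) *: iter i Dirac g x.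

Definition CK_at (g : vec -> clif) (x0 : R) (x : vec) (L : clif) : Prop :=
  forall A, (fun n => ck_psum g x0 x n A) @ \oo --> L A.

(* Fueter map for h = u + i v:
   Ft[h, P](x0,x) = Delta^{k + (m-1)/2} [(u(x0,r) + comega v(x0,r)) P(x)] *)
Definition Fueter (k : nat) (u v : R -> R -> R) (P : vec -> clif) : R -> vec -> clif :=
  iter (k + (m.-1)./2)%N lapl
    (fun y0 y => cmul (u y0 (rnorm y) *: cone1 + v y0 (rnorm y) *: comega y) (P y)).

Definition homog_poly (k : nat) (f : vec -> R) : Prop :=
  exists c : {ffun 'I_m -> 'I_k.+1} -> R, forall x : vec,
    f x = \sum_(a : {ffun 'I_m -> 'I_k.+1} | (\sum_j (a j : nat) == k)%N)
            c a * \prod_j xcoord x j ^+ a j.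

End Clifford.

Definition D_r {R : realType} (n : nat) (f : R -> R) : R -> R :=
  iter n (fun g r => r^-1 * derive1 g r) f.
Definition D_up {R : realType} (n : nat) (f : R -> R) : R -> R :=
  iter n (fun g => derive1 (fun s => g s / s)) f.

Fixpoint dfact (n : nat) : nat :=
  match n with
  | 0 => 1
  | 1 => 1
  | (n'.+2) as n2 => (n2 * dfact n')%N
  end.

(* Main.v *)
Require Import Defs.
From HB Require Import structures.
From mathcomp Require Import all_boot all_order all_algebra.
From mathcomp Require Import all_classical all_reals all_analysis.
From mathcomp Require Import ring lra zify.
Import Order.TTheory GRing.Theory Num.Theory.
Import numFieldNormedType.Exports.
Local Open Scope ring_scope.

(** Put [s = r ^ 2] and [xP = x P(x)].  Both [P] and [xP] are harmonic and
    homogeneous, of degrees [k] and [k + 1], so the Dirac operator and the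
    Laplacian act on fields [u(x0, s) P + v(x0, s) xP] as ordinary differential
    operators in [x0] and [s].  Let [al n] and [be n] be [(- d/ds)^n] of
    [exp (x0^2 - s) cos (2 x0 r)] and of [exp (x0^2 - s) sin (2 x0 r) / r].
    The Cauchy-Riemann equations yield a three-term recurrence in [n] for them,
    which gives all their derivatives without interchanging partial derivatives,
    and each side of the theorem equals [al N P + be N xP]:
    - the n-th Laplacian of [al 0 P + be 0 xP] is
      [(-4)^n N (N-1) ... (N-n+1) (al n P + be n xP)];
    - the sums in the closed formula are binomial transforms that undo the
      Leibniz rule for the factor [exp (- s)];
    - the i-th power of the Dirac operator sends [exp (- s) P] to [exp (- s)]
      times an explicit polynomial in [s] times [P] or [xP]; the resulting
      power series in [x0] is a Cauchy product of exponential and trigonometric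
      series when [N = 0], and the general case follows because its
      coefficients satisfy termwise the recurrence of [al] and [be]. *)

(** * Cauchy products *)

Section CauchyProduct.
Set Implicit Arguments.
Unset Strict Implicit.
Local Open Scope classical_set_scope.
Variable R : realType.
Implicit Types a b u : R^nat.

Lemma cvg_half : (fun n : nat => n./2) @ \oo --> \oo.
Proof.
move=> S [N _ NS]; exists N.*2 => // n /= Nn; apply: NS => /=.
by rewrite -(doubleK N); exact: half_leq.
Qed.

Lemma cvg_uphalf : (fun n : nat => uphalf n) @ \oo --> \oo.
Proof.
move=> S [N _ NS]; exists N.*2 => // n /= Nn; apply: NS => /=.
rewrite -(doubleK N); apply: leq_trans (half_leq Nn) _.
by rewrite uphalf_half leq_addl.
Qed.

Definition seqconv a b : R^nat := fun n => \sum_(l < n.+1) a l * b (n - l)%N.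

(** Grouping the index pairs by the first index leaves partial sums of [b], so the error against the
    full product can be estimated column by column. *)
Lemma series_seqconv a b K :
  series (seqconv a b) K = \sum_(l < K) a l * series b (K - l)%N.
Proof.
elim: K => [|K IH]; first by rewrite /series /= big_geq // big_ord0.
rewrite seriesSr IH /seqconv big_ord_recr /= [RHS]big_ord_recr /=.
rewrite subnn subSnn.
rewrite /series /= big_nat1 addrA -big_split /=; congr (_ + _).
apply: eq_bigr => l _; rewrite subSn; last exact: ltnW.
by rewrite big_nat_recr //= mulrDr.
Qed.

(* The difference only involves pairs of indices that are not both below [K./2]. *)
Lemma seqconv_series_dist a b K :
  `|series a K * series b K - series (seqconv a b) K| <=
  [normed series a] K * [normed series b] K
  - [normed series a] K./2 * [normed series b] K./2.
Proof.
pose na : R^nat := fun n => `|a n|; pose nb : R^nat := fun n => `|b n|.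
have nbm : {homo series nb : m n / (m <= n)%N >-> m <= n}.
  by apply: nondecreasing_series => n _ _; rewrite normr_ge0.
have nb0 n : 0 <= series nb n by rewrite sumr_ge0 // => i _; rewrite normr_ge0.
have dist m n : (m <= n)%N -> `|series b n - series b m| <= series nb n - series nb m.
  move=> mn; rewrite !sub_series_geq //; exact: ler_norm_sum.
rewrite series_seqconv; rewrite [in X in `|X|]/series /= big_mkord mulr_suml -sumrB.
apply: le_trans (ler_norm_sum _ _ _) _.
apply: (@le_trans _ _ (\sum_(l < K) na l * (series nb K - series nb (K - l)%N))).
  apply: ler_sum => l _; rewrite -mulrBr normrM; apply: ler_wpM2l => //.
  by apply: dist; exact: leq_subr.
under eq_bigr do rewrite mulrBr.
rewrite sumrB -mulr_suml -(big_mkord xpredT na); apply: lerB => //.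
rewrite {1}/series /= big_mkord mulr_suml.
have K2 : (K./2 <= K)%N by rewrite -{2}(odd_double_half K) -addnn addnA leq_addl.
rewrite (big_ord_widen _ (fun i => `|a i| * series nb K./2) K2) big_mkcond /=.
(* Columns with [l >= K./2] are dropped, their terms being nonnegative; in the others
   [K - l >= K./2] and the partial sums are monotone. *)
apply: ler_sum => l _; case: ifP => [lK|_]; last first.
  by rewrite mulr_ge0 // normr_ge0.
apply: ler_wpM2l => //; apply: nbm.
rewrite leq_subRL; last exact: ltnW.
apply: (@leq_trans (K./2 + K./2)); first by rewrite leq_add2r ltnW.
by rewrite addnn -[leqRHS](odd_double_half K) leq_addl.
Qed.

(** The bound of [seqconv_series_dist] is the difference of one convergent sequence taken at [K] and
    at [K./2], hence tends to zero. *)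
Lemma cvg_cauchy_product a b (A B : R) :
  cvgn [normed series a] -> cvgn [normed series b] ->
  series a @ \oo --> A -> series b @ \oo --> B ->
  series (seqconv a b) @ \oo --> A * B.
Proof.
move=> ca cb aA bB.
have half u : cvgn u -> (fun n => u n./2) @ \oo --> limn u.
  by move=> cu; apply: cvg_comp cvg_half _.
pose d K := [normed series a] K * [normed series b] K
  - [normed series a] K./2 * [normed series b] K./2.
have d0 : d @ \oo --> (0 : R).
  rewrite -(subrr (limn [normed series a] * limn [normed series b])).
  by apply: cvgB; apply: cvgM => //; exact: half.
have e0 : (fun K => series a K * series b K - series (seqconv a b) K) @ \oo --> (0 : R).
  apply/norm_cvg0P; apply: (@squeeze_cvgr _ _ _ _ (fun=> 0) _ _ _ _ _ d0).
    by apply: nearW => K; rewrite normr_ge0 seqconv_series_dist.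
  exact: cvg_cst.
rewrite (_ : series (seqconv a b) = fun K => series a K * series b K
    - (series a K * series b K - series (seqconv a b) K)); last first.
  by apply/funext => K; rewrite subKr.
by rewrite -[A * B]subr0; apply: cvgB e0; exact: cvgM.
Qed.

(** Grouping the absolute values in pairs keeps convergence, and each pair dominates its even
    term. *)
Lemma cvg_series_even u :
  cvgn [normed series u] -> cvgn [normed series (fun n => u n.*2)].
Proof.
move=> /(@cvg_series_cvg_series_group _ _ 2) /(_ isT) h.
have cg : cvgn (series (fun n => \sum_(n * 2 <= i < n.+1 * 2) `|u i|)).
  by apply/cvg_ex; eexists; exact: h.
apply: series_le_cvg cg => n; rewrite ?sumr_ge0 ?normr_ge0 //=.
by rewrite !muln2 doubleS big_nat_recl // lerDl sumr_ge0.
Qed.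

Lemma cvg_series_odd u :
  cvgn [normed series u] -> cvgn [normed series (fun n => u n.*2.+1)].
Proof.
move=> /(@cvg_series_cvg_series_group _ _ 2) /(_ isT) h.
have cg : cvgn (series (fun n => \sum_(n * 2 <= i < n.+1 * 2) `|u i|)).
  by apply/cvg_ex; eexists; exact: h.
apply: series_le_cvg cg => n; rewrite ?sumr_ge0 ?normr_ge0 //=.
by rewrite !muln2 doubleS big_nat_recr // lerDr sumr_ge0.
Qed.

End CauchyProduct.

(** * Polynomial parts of the Dirac iterates of the Gaussian *)

Section HermiteLike.
Set Implicit Arguments.
Unset Strict Implicit.
Variable R : realType.
Implicit Types p q : {poly R}.

(* [exp (- s) * pexpd p] is [- d/ds (exp (- s) * p)]. *)
Definition pexpd p : {poly R} := p - p^`().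
Notation T := pexpd.
Notation TT N := (iter N pexpd).

(* As polynomials in [s], the coefficients of [x0 ^ 2n] in
   [exp (x0^2) cos (2 x0 sqrt s)] and of [x0 ^ (2n+1)] in
   [exp (x0^2) sin (2 x0 sqrt s) / sqrt s]. *)
Definition even_pol n : {poly R} :=
  \poly_(l < n.+1) ((-4) ^+ l / ((n - l)`!%:R * l.*2`!%:R)).
Definition odd_pol n : {poly R} :=
  \poly_(l < n.+1) (2 * (-4) ^+ l / ((n - l)`!%:R * l.*2.+1`!%:R)).

Lemma pexpdD p q : T (p + q) = T p + T q.
Proof. by rewrite /T derivD opprD addrACA. Qed.

Lemma pexpdZ c p : T (c *: p) = c *: T p.
Proof. by rewrite /T derivZ scalerBr. Qed.

Lemma pexpd_mulX p : T ('X * p) = 'X * T p - p.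
Proof. by rewrite /T derivM derivX mul1r mulrBr opprD addrA addrAC. Qed.

Lemma iter_pexpdD N p q : TT N (p + q) = TT N p + TT N q.
Proof. by elim: N => //= N ->; rewrite pexpdD. Qed.

Lemma iter_pexpdZ N c p : TT N (c *: p) = c *: TT N p.
Proof. by elim: N => //= N ->; rewrite pexpdZ. Qed.

Lemma iter_pexpdB N p q : TT N (p - q) = TT N p - TT N q.
Proof. by rewrite -scaleN1r iter_pexpdD iter_pexpdZ scaleN1r. Qed.

(** [pexpd] and multiplication by ['X] have commutator minus the identity. At [N = 0] the index
    [N.-1] is junk, under the factor 0. *)
Lemma iter_pexpd_mulX N p :
  TT N ('X * p) = 'X * TT N p - N%:R *: TT N.-1 p.
Proof.
elim: N => [|N IH] /=; first by rewrite scale0r subr0.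
rewrite IH -scaleN1r pexpdD pexpd_mulX !pexpdZ scaleN1r.
case: N {IH} => [|N] /=; first by rewrite !scale0r scale1r subr0.
by rewrite -[N.+2%:R]natr1 scalerDl scale1r [- (_ *: _ + _)]opprD
  [RHS]addrA [RHS]addrAC.
Qed.

Lemma factr_neq0 n : n`!%:R != 0 :> R.
Proof. by rewrite pnatr_eq0 -lt0n fact_gt0. Qed.

Lemma natrS_neq0 n : n%:R + 1 != 0 :> R.
Proof. by rewrite natr1 pnatr_eq0. Qed.

Lemma dbl_natr n : n.*2%:R = 2 * n%:R :> R.
Proof. by rewrite -mul2n natrM. Qed.

(** With [E] and [O] the two generating functions in [x0], this is the coefficient form of
    [dE/ds = - x0 O]; the next two identities are [s dO/ds = x0 E - O / 2] and
    [dE/dx0 = 2 x0 E - 2 s O]. *)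
Lemma deriv_even_polS n : (even_pol n.+1)^`() = - odd_pol n.
Proof.
apply/polyP => l; rewrite coef_deriv coefN !coef_poly ltnS.
case: ltnP => [ln|_]; last by rewrite mul0rn oppr0.
rewrite subSS doubleS (factS l.*2.+1) natrM exprS -mulr_natr.
rewrite -[l.*2.+2%:R]natr1 -[l.*2.+1%:R]natr1 dbl_natr -natr1.
field; rewrite !factr_neq0 /= (_ : 2 * l%:R + 1 + 1 = 2 * (l%:R + 1)); last by ring.
by rewrite mulf_neq0 ?natrS_neq0.
Qed.

Lemma mulX_deriv_odd_pol n :
  'X * (odd_pol n)^`() = even_pol n - 2^-1 *: odd_pol n.
Proof.
apply/polyP => -[|l]; rewrite coefXM coefB coefZ ?coef_deriv !coef_poly /=.
  by field; rewrite !factr_neq0.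
case: ltnP => [ln|_]; last by rewrite mul0rn mulr0 subr0.
rewrite (factS l.+1.*2) natrM -mulr_natr -[l.+1.*2.+1%:R]natr1 dbl_natr.
have l0 : 0 <= l.+1%:R :> R by exact: ler0n.
by field; rewrite !factr_neq0 andbT; apply/lt0r_neq0; lra.
Qed.

Lemma even_polS n : n.+1%:R *: even_pol n.+1 = even_pol n - 'X * odd_pol n.
Proof.
apply/polyP => -[|l]; rewrite coefB coefXM coefZ !coef_poly /=.
  rewrite !subn0 factS natrM -natr1.
  by field; rewrite !factr_neq0 natrS_neq0.
rewrite (ltnS l.+1) (ltnS l.+1).
case: (ltnP l n.+1) => [ln|nl]; last first.
  by rewrite ltnNge (leq_trans _ nl) ?leqnSn //= mulr0 subr0.
rewrite doubleS (factS l.*2.+1) natrM exprS.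
rewrite -[l.*2.+2%:R]natr1 -[l.*2.+1%:R]natr1 dbl_natr.
have l2 : 2 * l%:R + 1 + 1 != 0 :> R.
  by rewrite (_ : _ + 1 = 2 * (l%:R + 1)) ?mulf_neq0 ?natrS_neq0 //; ring.
case: (ltnP l n) => [ln'|nl]; last first.
  have e : l = n by apply/eqP; rewrite eqn_leq nl andbT.
  move: l2; rewrite e !subnn -natr1 => l2.
  by field; rewrite !factr_neq0 l2.
have [d ->] : exists d, n = (d + l.+1)%N by exists (n - l.+1)%N; rewrite subnK.
rewrite subSS addnK -addSnnS addnK factS natrM -[(_ + _).+1%:R]natr1 natrD.
rewrite -[d.+1%:R]natr1.
by field; rewrite !factr_neq0 natrS_neq0.
Qed.

Lemma even_pol0 : even_pol 0 = 1.
Proof.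
apply/polyP => -[|l]; rewrite coef_poly coef1 //=.
by rewrite /= double0 fact0 mulr1 divr1.
Qed.

Lemma pexpd_even_pol0 : T (even_pol 0) = even_pol 0.
Proof. by rewrite even_pol0 /T -polyC1 derivC subr0. Qed.

Lemma pexpd_even_polS n : T (even_pol n.+1) = even_pol n.+1 + odd_pol n.
Proof. by rewrite /T deriv_even_polS opprK. Qed.

Lemma mulX_pexpd_odd_pol n :
  'X * T (odd_pol n) = ('X + 2^-1%:P) * odd_pol n - even_pol n.
Proof.
by rewrite /T mulrBr mulX_deriv_odd_pol mulrDl mul_polyC opprB addrA addrAC.
Qed.

(** The case [N = 0] is [mulX_pexpd_odd_pol]; commuting the iterate past ['X] produces the terms in
    [N]. This is the recurrence of [be], read on the coefficients of the powers of [x0]. *)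
Lemma iter_pexpd_odd_polS N n :
  'X * TT N.+1 (odd_pol n) = ('X + (2^-1 + N%:R)%:P) * TT N (odd_pol n)
    - N%:R *: TT N.-1 (odd_pol n) - TT N (even_pol n).
Proof.
have := congr1 (iter N T) (mulX_pexpd_odd_pol n).
rewrite !mulrDl iter_pexpdB iter_pexpdD !iter_pexpd_mulX !mul_polyC iter_pexpdZ.
rewrite -!iterSr => /polyP e; apply/polyP => l; move: (e l).
case: N {e} => [|N]; rewrite !(coefD, coefB, coefN, coefZ) /=; lra.
Qed.

(** Differentiating [even_polS] and substituting the known derivatives gives this relation, which
    governs a Dirac step from an even iterate to an odd one. *)
Lemma pexpd_even_pol n : T (even_pol n) = (n%:R + 2^-1) *: odd_pol n.
Proof.
have := congr1 (@deriv R) (even_polS n).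
rewrite derivZ deriv_even_polS derivB derivM derivX mul1r mulX_deriv_odd_pol.
move=> e; apply/polyP => l; move/polyP/(_ l): e.
rewrite /T !(coefB, coefN, coefD, coefZ) -natr1 => e.
lra.
Qed.

(** For [N = 0] this follows from [even_polS]; commuting the iterate past ['X] raises the
    coefficient 1 to [2 * N + 1], the value of [m + 2 * k] met by the Dirac operator on multiples of
    [xP]. *)
Lemma iter_pexpd_odd_pol N n :
  (2 * N + 1)%:R *: TT N (odd_pol n) - 2 *: ('X * TT N.+1 (odd_pol n))
  = (2 * n.+1%:R) *: TT N (even_pol n.+1).
Proof.
have e : odd_pol n - 2 *: ('X * T (odd_pol n)) = (2 * n.+1%:R) *: even_pol n.+1.
  rewrite -scalerA even_polS mulX_pexpd_odd_pol; apply/polyP => l.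
  by rewrite !(coefD, coefB, coefN, coefZ, mulrDl, mul_polyC); lra.
rewrite -[RHS]iter_pexpdZ -e iter_pexpdB iter_pexpdZ iter_pexpd_mulX -!iterSr.
case: N => [|N]; first by rewrite !scale0r subr0 scale1r.
apply/polyP => l; rewrite !(coefD, coefB, coefN, coefZ) natrD natrM /=; lra.
Qed.

Lemma pexpd_gauss_derive p s :
  is_derive s (1 : R) (fun t => expR (- t) * p.[t]) (- (expR (- s) * (T p).[s])).
Proof.
have h1 : is_derive s (1 : R) (fun t => expR (- t)) (expR (- s) * -1).
  exact: (@is_derive1_comp _ expR (fun t => - t)).
have h2 := is_deriveM h1 (is_derive_poly p s).
apply: is_derive_eq h2 _.
rewrite /T hornerD hornerN /GRing.scale /=; ring.
Qed.

End HermiteLike.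

(** * The recurrence for the radial coefficients *)

Section AlphaBeta.
Set Implicit Arguments.
Unset Strict Implicit.
Variable R : realType.
Implicit Types s : R.

Definition al0 x0 s : R := expR (x0 ^+ 2 - s) * cos (2 * x0 * Num.sqrt s).
Definition be0 x0 s : R :=
  expR (x0 ^+ 2 - s) * (sin (2 * x0 * Num.sqrt s) / Num.sqrt s).

(* The third component is the previous value of the second one, with junk value
   0 at [n = 0], where it is multiplied by [n]. *)
Fixpoint albe x0 s (n : nat) : R * R * R :=
  if n is n'.+1 then
    let: (a, b, c) := albe x0 s n' in
    (a + x0 * b, ((s + 2^-1 + n'%:R) * b - n'%:R * c - x0 * a) / s, b)
  else (al0 x0 s, be0 x0 s, 0).

Definition al n x0 s := (albe x0 s n).1.1.
Definition be n x0 s := (albe x0 s n).1.2.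

Lemma alS n x0 s : al n.+1 x0 s = al n x0 s + x0 * be n x0 s.
Proof. by rewrite /al /be /=; case: albe => [[a b] c]. Qed.

Lemma beS n x0 s : be n.+1 x0 s =
  ((s + 2^-1 + n%:R) * be n x0 s - n%:R * be n.-1 x0 s - x0 * al n x0 s) / s.
Proof.
rewrite /be /al /=; case: n => [|n] /=; first by rewrite !mul0r.
by case: albe => [[a b] c].
Qed.

Local Open Scope classical_set_scope.

Lemma cvg_eqfun (u v : R^nat) (l l' : R) :
  u @ \oo --> l -> u =1 v -> l = l' -> v @ \oo --> l'.
Proof. by move=> ul /funext <- <-. Qed.

Lemma cvg_series_conv_exp (y : R) (u : R^nat) (U : R) :
  cvgn [normed series u] -> series u @ \oo --> U ->
  series (fun n => \sum_(l < n.+1) y ^+ (n - l) / (n - l)`!%:R * u l) @ \oo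
    --> expR y * U.
Proof.
move=> cu uU.
have -> : (fun n => \sum_(l < n.+1) y ^+ (n - l) / (n - l)`!%:R * u l)
    = seqconv (exp_coeff y) u.
  apply/funext => n; rewrite /seqconv (reindex_inj rev_ord_inj) /=.
  apply: eq_bigr => l _; rewrite subSS subKn; last by rewrite -ltnS.
  by rewrite /exp_coeff.
apply: cvg_cauchy_product => //.
- by rewrite normed_series_exp_coeff; exact: is_cvg_series_exp_coeff.
- exact: is_cvg_series_exp_coeff.
Qed.

Lemma normed_series_cos_coeff x : cvgn [normed series (@cos_coeff R x)].
Proof.
apply: series_le_cvg; last exact: (is_cvg_series_exp_coeff `|x|).
- by move=> n; rewrite normr_ge0.
- by move=> n; rewrite divr_ge0.
- move=> n /=; rewrite !normrM normfV !normr_nat !normrX normrN normr1 expr1n.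
  by rewrite mulr1 /exp_coeff /=; case: odd; rewrite ?mul0r ?mul1r.
Qed.

Lemma normed_series_sin_coeff x : cvgn [normed series (@sin_coeff R x)].
Proof.
apply: series_le_cvg; last exact: (is_cvg_series_exp_coeff `|x|).
- by move=> n; rewrite normr_ge0.
- by move=> n; rewrite divr_ge0.
- move=> n /=; rewrite !normrM normfV !normr_nat !normrX normrN normr1 expr1n.
  by rewrite mulr1 /exp_coeff /=; case: odd; rewrite ?mul0r ?mul1r.
Qed.

(** The factor [expR s] removes the Gaussian from [al 0]. What remains is the product of the
    exponential series at [x0 ^+ 2] and the cosine series, with the terms shown as its Cauchy
    coefficients. *)
Lemma cvg_series_even_pol0 x0 s : 0 < s ->
  series (fun n => x0 ^+ n.*2 * (even_pol R n).[s]) @ \oo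
    --> expR s * al 0 x0 s.
Proof.
move=> s0; have ss : Num.sqrt s ^+ 2 = s by rewrite sqr_sqrtr // ltW.
rewrite /al /= /al0 mulrA -expRD (addrC s) subrK.
have h : cvgn [normed series (cos_coeff' (2 * x0 * Num.sqrt s))].
  have := cvg_series_even (@normed_series_cos_coeff (2 * x0 * Num.sqrt s)).
  by under eq_fun do rewrite -cos_coeff'E.
apply: (cvg_eqfun (cvg_series_conv_exp (y := x0 ^+ 2) h (@cvg_cos_coeff' _ _))) => // K.
apply: eq_bigr => n _.
rewrite horner_poly mulr_sumr; apply: eq_bigr => l _.
have ln : (l <= n)%N by rewrite -ltnS.
have -> : x0 ^+ n.*2 = (x0 ^+ 2) ^+ (n - l) * (x0 ^+ 2) ^+ l.
  by rewrite -exprD subnK // -exprM mul2n.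
have sq (c : R) : (c * Num.sqrt s) ^+ l.*2 = (c ^+ 2) ^+ l * s ^+ l.
  by rewrite -mul2n exprM (exprMn 2) ss (exprMn l).
rewrite /cos_coeff' sq.
rewrite (_ : -4 = -1 * 2 ^+ 2); last by rewrite expr2; ring.
rewrite (exprMn 2) !(exprMn l) -exprnP.
by field; rewrite !factr_neq0.
Qed.

Lemma cvg_series_odd_pol0 x0 s : 0 < s ->
  series (fun n => x0 ^+ n.*2.+1 * (odd_pol R n).[s]) @ \oo
    --> expR s * be 0 x0 s.
Proof.
move=> s0; have ss : Num.sqrt s ^+ 2 = s by rewrite sqr_sqrtr // ltW.
have rs0 : Num.sqrt s != 0 by rewrite gt_eqF // sqrtr_gt0.
rewrite /be /= /be0 mulrA -expRD (addrC s) subrK.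
have h : cvgn [normed series (sin_coeff' (2 * x0 * Num.sqrt s))].
  have := cvg_series_odd (@normed_series_sin_coeff (2 * x0 * Num.sqrt s)).
  by under eq_fun do rewrite -sin_coeff'E.
have cs := cvg_series_conv_exp (y := x0 ^+ 2) h (@cvg_sin_coeff' _ _).
apply: (cvg_eqfun (cvgMr_tmp (b := (Num.sqrt s)^-1) cs)) => [K|]; last first.
  by rewrite mulrA.
rewrite /series /= mulr_suml; apply: eq_bigr => n _.
rewrite horner_poly mulr_sumr mulr_suml; apply: eq_bigr => l _.
have ln : (l <= n)%N by rewrite -ltnS.
have -> : x0 ^+ n.*2.+1 = x0 * ((x0 ^+ 2) ^+ (n - l) * (x0 ^+ 2) ^+ l).
  by rewrite -exprD subnK // -exprM mul2n exprS.
have sq (c : R) : (c * Num.sqrt s) ^+ l.*2 = (c ^+ 2) ^+ l * s ^+ l.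
  by rewrite -mul2n exprM (exprMn 2) ss (exprMn l).
rewrite /sin_coeff' [(_ * Num.sqrt s) ^+ _]exprS sq.
rewrite (_ : -4 = -1 * 2 ^+ 2); last by rewrite expr2; ring.
rewrite (exprMn 2) !(exprMn l) -exprnP.
by field; rewrite !factr_neq0.
Qed.

(** No series is differentiated termwise: the terms satisfy the linear recurrence of [al] and [be],
    so convergence passes to [N.+1] from the two preceding indices. *)
Lemma cvg_series_pol N x0 s : 0 < s ->
  (series (fun n => x0 ^+ n.*2 * (iter N (@pexpd R) (even_pol R n)).[s]) @ \oo
    --> expR s * al N x0 s) /\
  (series (fun n => x0 ^+ n.*2.+1 * (iter N (@pexpd R) (odd_pol R n)).[s]) @ \oo
    --> expR s * be N x0 s).
Proof.
move=> s0; elim/ltn_ind: N => -[_|N IH].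
  by split; [exact: cvg_series_even_pol0|exact: cvg_series_odd_pol0].
have [ha hb] := IH N (ltnSn N).
(* For [N = 0] this is the case 0 again; it enters with coefficient [N%:R = 0]. *)
have [_ hb'] : _ /\ _ := IH N.-1 (leq_pred N).
have sn0 : s != 0 by rewrite gt_eqF.
have TS p : pexpd (iter N (@pexpd R) p) = iter N (@pexpd R) (pexpd p).
  by rewrite -iterS iterSr.
split.
  rewrite alS mulrDr.
  (* Multiplying the odd series by [x0] gives the powers [x0 ^+ n.*2] with [n > 0]; a zero term in
     front aligns the indices. *)
  have hb1 : series (fun n => if n is n'.+1 then
       x0 ^+ n'.*2.+2 * (iter N (@pexpd R) (odd_pol R n')).[s] else 0) @ \oo
     --> expR s * (x0 * be N x0 s).
    rewrite -(cvg_shiftS (series _)) mulrCA.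
    apply: (cvg_eqfun (cvgMl_tmp (a := x0) hb)) => // K.
    rewrite /series /= big_nat_recl // add0r mulr_sumr.
    by apply: eq_bigr => n _; rewrite [in RHS]exprS mulrA.
  apply: (cvg_eqfun (cvgD ha hb1)) => // K.
  rewrite -[LHS]/(series _ K + series _ K) /series /= -big_split /=.
  apply: eq_bigr => -[|n] _.
    by rewrite TS pexpd_even_pol0 addr0.
  by rewrite TS pexpd_even_polS iter_pexpdD hornerD mulrDr doubleS.
rewrite beS.
have -> : expR s * (((s + 2^-1 + N%:R) * be N x0 s - N%:R * be N.-1 x0 s
     - x0 * al N x0 s) / s)
   = (s + 2^-1 + N%:R) / s * (expR s * be N x0 s) +
     (- N%:R / s) * (expR s * be N.-1 x0 s) +
     (- x0 / s) * (expR s * al N x0 s) by field.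
apply: (cvg_eqfun (cvgD (cvgD (cvgMl_tmp (a := (s + 2^-1 + N%:R) / s) hb)
  (cvgMl_tmp (a := - N%:R / s) hb')) (cvgMl_tmp (a := - x0 / s) ha))) => // K.
rewrite -[LHS]/(_ * series _ K + _ * series _ K + _ * series _ K) /series /=.
rewrite !mulr_sumr -!big_split /=; apply: eq_bigr => n _.
rewrite -?iterS; have := iter_pexpd_odd_polS R N n.
move: (iter N.+1 _ (odd_pol R n)) => Q /(congr1 (horner^~ s)).
rewrite !(hornerD, hornerN, hornerM, hornerX, hornerZ, hornerC) => e.
by rewrite -[Q.[s]](mulKf sn0) e exprS; field.
Qed.

End AlphaBeta.

(** * Derivatives of the radial coefficients *)

Section AlphaBetaDerivatives.
Set Implicit Arguments.
Unset Strict Implicit.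
Variable R : realType.
Implicit Types f g : R -> R.

Lemma is_derive1D f g (x a b : R) : is_derive x (1 : R) f a -> is_derive x (1 : R) g b ->
  is_derive x (1 : R) (fun t => f t + g t) (a + b).
Proof. exact: is_deriveD. Qed.

Lemma is_derive1B f g (x a b : R) : is_derive x (1 : R) f a -> is_derive x (1 : R) g b ->
  is_derive x (1 : R) (fun t => f t - g t) (a - b).
Proof. exact: is_deriveB. Qed.

Lemma is_derive1M f g (x a b : R) : is_derive x (1 : R) f a -> is_derive x (1 : R) g b ->
  is_derive x (1 : R) (fun t => f t * g t) (a * g x + f x * b).
Proof.
by move=> fa gb; apply: is_derive_eq (is_deriveM fa gb) _; rewrite addrC mulrC.
Qed.

Lemma is_derive1Z f (c x a : R) : is_derive x (1 : R) f a ->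
  is_derive x (1 : R) (fun t => c * f t) (c * a).
Proof. exact: is_deriveZ. Qed.

Lemma is_derive1C (c x : R) : is_derive x (1 : R) (fun=> c) 0.
Proof. exact: is_derive_cst. Qed.

Lemma is_derive1_sum (I : finType) (h : I -> R -> R) (dh : I -> R) (x : R) :
  (forall i, is_derive x (1 : R) (h i) (dh i)) ->
  is_derive x (1 : R) (fun t => \sum_i h i t) (\sum_i dh i).
Proof.
move=> hd; elim: (index_enum I) => [|i r IH].
  under eq_fun do rewrite big_nil.
  by rewrite big_nil; exact: is_derive1C.
under eq_fun do rewrite big_cons.
by rewrite big_cons; exact: is_derive1D.
Qed.

Lemma is_derive1_val f (x a b : R) : is_derive x (1 : R) f a -> a = b ->
  is_derive x (1 : R) f b.
Proof. by move=> + <-. Qed.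

Lemma al0_derive_s (x0 s : R) : 0 < s ->
  is_derive s (1 : R) (al 0 x0) (- al 1 x0 s).
Proof.
move=> s0; have rs0 : Num.sqrt s != 0 by rewrite gt_eqF // sqrtr_gt0.
have dq := @is_derive1_sqrt _ _ s0.
have de : is_derive s (1 : R) (fun t => expR (x0 ^+ 2 - t))
    (expR (x0 ^+ 2 - s) * (0 - 1)).
  exact: (@is_derive1_comp _ expR (fun t => x0 ^+ 2 - t)).
have dc : is_derive s (1 : R) (fun t => cos (2 * x0 * Num.sqrt t))
    (- sin (2 * x0 * Num.sqrt s) * (2 * x0 * (2 * Num.sqrt s)^-1)).
  exact: (@is_derive1_comp _ (@cos R) (fun t => 2 * x0 * Num.sqrt t)).
apply: is_derive1_val (is_derive1M de dc) _.
by rewrite alS /al /be /= /al0 /be0; field.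
Qed.

Lemma be0_derive_s (x0 s : R) : 0 < s ->
  is_derive s (1 : R) (be 0 x0) (- be 1 x0 s).
Proof.
move=> s0; have rs0 : Num.sqrt s != 0 by rewrite gt_eqF // sqrtr_gt0.
have ss : Num.sqrt s ^+ 2 = s by rewrite sqr_sqrtr // ltW.
have dq := @is_derive1_sqrt _ _ s0.
have de : is_derive s (1 : R) (fun t => expR (x0 ^+ 2 - t))
    (expR (x0 ^+ 2 - s) * (0 - 1)).
  exact: (@is_derive1_comp _ expR (fun t => x0 ^+ 2 - t)).
have dc : is_derive s (1 : R) (fun t => sin (2 * x0 * Num.sqrt t))
    (cos (2 * x0 * Num.sqrt s) * (2 * x0 * (2 * Num.sqrt s)^-1)).
  exact: (@is_derive1_comp _ (@sin R) (fun t => 2 * x0 * Num.sqrt t)).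
apply: is_derive1_val (is_derive1M de (is_derive1M dc (is_deriveV rs0 dq))) _.
rewrite beS /al /be /= /al0 /be0 /GRing.scale /= !mul0r.
move: (Num.sqrt s) (expR _) (cos _) (sin _) rs0 ss => q e c si q0 <-.
by field.
Qed.

Lemma al0_derive_x (s x0 : R) : 0 < s ->
  is_derive x0 (1 : R) (al 0 ^~ s) (be 0 x0 s - 2 * s * be 1 x0 s).
Proof.
move=> s0; have rs0 : Num.sqrt s != 0 by rewrite gt_eqF // sqrtr_gt0.
have ss : Num.sqrt s ^+ 2 = s by rewrite sqr_sqrtr // ltW.
have de : is_derive x0 (1 : R) (fun t => expR (t ^+ 2 - s))
    (expR (x0 ^+ 2 - s) * (1 * x0 + x0 * 1 - 0)).
  apply: (@is_derive1_comp _ expR (fun t => t ^+ 2 - s)).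
  exact: (is_derive1B (is_derive1M (is_derive_id x0 (1 : R))
    (is_derive_id x0 (1 : R))) (is_derive1C s x0)).
have dq : is_derive x0 (1 : R) (fun t => 2 * t * Num.sqrt s)
    (2 * 1 * Num.sqrt s + 2 * x0 * 0).
  exact: is_derive1M.
have dc : is_derive x0 (1 : R) (fun t => cos (2 * t * Num.sqrt s))
    (- sin (2 * x0 * Num.sqrt s) * (2 * 1 * Num.sqrt s + 2 * x0 * 0)).
  exact: (@is_derive1_comp _ (@cos R) (fun t => 2 * t * Num.sqrt s)).
apply: is_derive1_val (is_derive1M de dc) _.
rewrite beS /al /be /= /al0 /be0 !mul0r.
move: (Num.sqrt s) (expR _) (cos _) (sin _) rs0 ss => q e c si q0 <-.
by field.
Qed.

Lemma be0_derive_x (s x0 : R) : 0 < s ->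
  is_derive x0 (1 : R) (be 0 ^~ s) (2 * al 1 x0 s).
Proof.
move=> s0; have rs0 : Num.sqrt s != 0 by rewrite gt_eqF // sqrtr_gt0.
have de : is_derive x0 (1 : R) (fun t => expR (t ^+ 2 - s))
    (expR (x0 ^+ 2 - s) * (1 * x0 + x0 * 1 - 0)).
  apply: (@is_derive1_comp _ expR (fun t => t ^+ 2 - s)).
  exact: (is_derive1B (is_derive1M (is_derive_id x0 (1 : R))
    (is_derive_id x0 (1 : R))) (is_derive1C s x0)).
have dq : is_derive x0 (1 : R) (fun t => 2 * t * Num.sqrt s)
    (2 * 1 * Num.sqrt s + 2 * x0 * 0).
  exact: is_derive1M.
have dc : is_derive x0 (1 : R) (fun t => sin (2 * t * Num.sqrt s))
    (cos (2 * x0 * Num.sqrt s) * (2 * 1 * Num.sqrt s + 2 * x0 * 0)).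
  exact: (@is_derive1_comp _ (@sin R) (fun t => 2 * t * Num.sqrt s)).
apply: is_derive1_val (is_derive1M de (is_derive1M dc (is_derive1C _ _))) _.
by rewrite alS /al /be /= /al0 /be0; field.
Qed.

(** For [n = 0] the derivatives in [x0] are the Cauchy-Riemann equations of [exp (z^2)] in the
    variable [s]. Later cases differentiate [alS] and [beS]; the summand [2 * n%:R] is what
    [(- d/ds)^n] yields in crossing the factor [s]. *)
Lemma albe_derive n (x0 s : R) : 0 < s ->
  [/\ is_derive s (1 : R) (al n x0) (- al n.+1 x0 s),
      is_derive s (1 : R) (be n x0) (- be n.+1 x0 s),
      is_derive x0 (1 : R) (al n ^~ s)
        ((2 * n%:R + 1) * be n x0 s - 2 * s * be n.+1 x0 s) &
      is_derive x0 (1 : R) (be n ^~ s) (2 * al n.+1 x0 s)].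
Proof.
move=> s0; have sn0 : s != 0 by rewrite gt_eqF.
elim/ltn_ind: n => -[_|n IH].
  rewrite mulr0 add0r mul1r; split.
  - exact: al0_derive_s.
  - exact: be0_derive_s.
  - exact: al0_derive_x.
  - exact: be0_derive_x.
have [das dbs dax dbx] := IH n (ltnSn n).
have [_ dcs _ dcx] := IH n.-1 (leq_pred n).
(* [n.-1.+1] differs from [n] only at [n = 0], where the factor [n%:R] vanishes; so the derivative
   of the [be n.-1] term is expressed uniformly in [n]. *)
have n0 : n%:R * be n x0 s = n%:R * be n.-1.+1 x0 s :> R.
  by case: n {IH das dbs dax dbx dcs dcx} => [|n] //; rewrite !mul0r.
have n1 : n%:R * al n x0 s = n%:R * al n.-1.+1 x0 s :> R.
  by case: n {IH das dbs dax dbx dcs dcx n0} => [|n] //; rewrite !mul0r.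
split.
- have -> : al n.+1 x0 = fun t => al n x0 t + x0 * be n x0 t.
    by apply/funext => t; rewrite alS.
  apply: is_derive1_val (is_derive1D das (is_derive1Z x0 dbs)) _.
  by rewrite [in RHS]alS; ring.
- have -> : be n.+1 x0 = fun t => ((t + 2^-1 + n%:R) * be n x0 t
      - n%:R * be n.-1 x0 t - x0 * al n x0 t) * t^-1.
    by apply/funext => t; rewrite beS.
  have dV : is_derive s (1 : R) (fun t => t^-1) (- s ^- 2 *: 1).
    exact: is_deriveV sn0 (is_derive_id _ _).
  have dl : is_derive s (1 : R) (fun t => t + 2^-1 + n%:R) (1 + 0 + 0).
    exact: (is_derive1D (is_derive1D (is_derive_id s (1 : R)) (is_derive1C 2^-1 s))
      (is_derive1C n%:R s)).
  apply: is_derive1_val (is_derive1M (is_derive1B (is_derive1B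
    (is_derive1M dl dbs) (is_derive1Z n%:R dcs)) (is_derive1Z x0 das)) dV) _.
  rewrite [n%:R * - _]mulrN -n0.
  rewrite [be n.+2 x0 s]beS /= /GRing.scale /= -natr1 alS.
  by rewrite beS; field.
- have -> : (al n.+1)^~ s = fun t => al n t s + t * be n t s.
    by apply/funext => t; rewrite alS.
  apply: is_derive1_val (is_derive1D dax (is_derive1M (is_derive_id _ _) dbx)) _.
  by rewrite [be n.+2 x0 s]beS /= -natr1 alS; field.
- have -> : (be n.+1)^~ s = fun t => s^-1 * ((s + 2^-1 + n%:R) * be n t s
      - n%:R * be n.-1 t s - t * al n t s).
    by apply/funext => t; rewrite beS mulrC.
  apply: is_derive1_val (is_derive1Z s^-1 (is_derive1B (is_derive1B
    (is_derive1Z (s + 2^-1 + n%:R) dbx) (is_derive1Z n%:R dcx))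
    (is_derive1M (is_derive_id _ _) dax))) _.
  rewrite [n%:R * (2 * _)]mulrCA -n1 [al n.+2 x0 s]alS alS; by field.
Qed.

End AlphaBetaDerivatives.

(** * The operators [D_r] and [D_up] *)

Section ClosedForm.
Set Implicit Arguments.
Unset Strict Implicit.
Variable R : realType.

Definition bintrans (f : nat -> R) (n : nat) : R :=
  \sum_(j < n.+1) 'C(n, j)%:R * (-1) ^+ j * f j.

Lemma bintransB f g n :
  bintrans (fun j => f j - g j) n = bintrans f n - bintrans g n.
Proof. by rewrite /bintrans -sumrB; apply: eq_bigr => j _; rewrite mulrBr. Qed.

Lemma bintransS f n :
  bintrans f n.+1 = bintrans f n - bintrans (fun j => f j.+1) n.
Proof.
rewrite /bintrans big_ord_recl /= bin0.
under eq_bigr do rewrite /= /bump /= add1n binS natrD mulrDl mulrDl.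
rewrite big_split /= addrA; congr (_ + _); last first.
  by rewrite -sumrN; apply: eq_bigr => j _; rewrite exprS mulN1r mulrN mulNr.
rewrite [in LHS]big_ord_recr /= bin_small // !mul0r addr0.
rewrite [in RHS]big_ord_recl /= bin0; congr (_ + _).
Qed.

(** By [bintransS] the transform turns the shift [S] into [1 - S], and doing so twice restores
    [S]. *)
Lemma bintransK f n : bintrans (bintrans f) n = f n.
Proof.
elim: n f => [|n IH] f.
  by rewrite /bintrans !big_ord1 /= !bin0 !expr0 !mul1r.
rewrite bintransS (_ : (fun j => _) =
    fun j => bintrans f j - bintrans (fun i => f i.+1) j).
  by rewrite bintransB !IH subKr.
by apply/funext => j; rewrite bintransS.
Qed.

Lemma derive1_pos (f g : R -> R) (r d : R) :
  (forall t, 0 < t -> f t = g t) -> 0 < r -> is_derive r (1 : R) g d ->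
  derive1 f r = d.
Proof.
move=> fg r0 gd; rewrite derive1E.
have fd : is_derive r (1 : R) f d.
  by apply: near_eq_is_derive gd; near=> t; rewrite fg //; near: t; exact: lt_nbhsr.
by case: fd.
Unshelve. all: by end_near. Qed.

Lemma is_derive_comp_sqr (c : R -> R) (r d : R) :
  is_derive (r ^+ 2) (1 : R) c d ->
  is_derive r (1 : R) (fun t => c (t ^+ 2)) (d * (2 * r)).
Proof.
move=> h; apply: (@is_derive1_comp _ c (fun t => t ^+ 2)).
apply: is_derive1_val (is_derive1M (is_derive_id r (1 : R)) (is_derive_id r (1 : R))) _.
ring.
Qed.

Section Chain.
Variable c : nat -> R -> R.
Hypothesis c_derive : forall n (s : R), 0 < s -> is_derive s (1 : R) (c n) (c n.+1 s).

(** In the variable [s = r ^ 2] the operator [r^-1 d/dr] is [2 d/ds]. *)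
Lemma D_r_comp_sqr (f : R -> R) n : (forall r, 0 < r -> f r = c 0 (r ^+ 2)) ->
  forall r, 0 < r -> D_r n f r = 2 ^+ n * c n (r ^+ 2).
Proof.
move=> fc; elim: n => [|n IH] r r0 /=; first by rewrite mul1r fc.
have r2 : 0 < r ^+ 2 by rewrite exprn_gt0.
rewrite (derive1_pos IH r0 (is_derive1Z _ (is_derive_comp_sqr (c_derive n r2)))).
by rewrite [2 ^+ n.+1]exprS; field; rewrite gt_eqF.
Qed.

(** Conjugation by multiplication by [r] carries [D_r] into [D_up]. *)
Lemma D_up_mul_comp_sqr (f : R -> R) n :
  (forall r, 0 < r -> f r = r * c 0 (r ^+ 2)) ->
  forall r, 0 < r -> D_up n f r = r * (2 ^+ n * c n (r ^+ 2)).
Proof.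
move=> fc; elim: n => [|n IH] r r0 /=; first by rewrite mul1r fc.
have r2 : 0 < r ^+ 2 by rewrite exprn_gt0.
rewrite (derive1_pos (g := fun t => 2 ^+ n * c n (t ^+ 2)) _ r0
  (is_derive1Z _ (is_derive_comp_sqr (c_derive n r2)))).
  by rewrite [2 ^+ n.+1]exprS; ring.
by move=> t t0; rewrite IH // mulrAC mulfV ?mul1r // gt_eqF.
Qed.

End Chain.

(** The Leibniz terms combine by [bintransS], so these functions form a chain of derivatives. The
    factor [expR (t - b)] is there to cancel the Gaussian in [al] and [be], leaving trigonometric
    functions at [n = 0]. *)
Lemma expR_bintrans_derive (a : nat -> R -> R) (b : R) :
  (forall n (s : R), 0 < s -> is_derive s (1 : R) (a n) (- a n.+1 s)) ->
  forall n (s : R), 0 < s ->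
  is_derive s (1 : R) (fun t => expR (t - b) * bintrans (a ^~ t) n)
    (expR (s - b) * bintrans (a ^~ s) n.+1).
Proof.
move=> ad n s s0.
have de : is_derive s (1 : R) (fun t => expR (t - b)) (expR (s - b) * (1 - 0)).
  exact: (@is_derive1_comp _ expR (fun t => t - b)).
have db : is_derive s (1 : R) (fun t => bintrans (a ^~ t) n)
    (\sum_(j < n.+1) 'C(n, j)%:R * (-1) ^+ j * - a j.+1 s).
  by apply: is_derive1_sum => j; apply: is_derive1Z; exact: ad.
apply: is_derive1_val (is_derive1M de db) _.
rewrite bintransS subr0 mulr1 mulrBr; congr (_ + _).
rewrite -mulrN /bintrans -sumrN; congr (_ * _); apply: eq_bigr => j _.
by rewrite mulrN.
Qed.

(** The exponentials cancel, and the powers of 2 do so up to [(-1) ^+ j]; the sum is then the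
    transform of a transform. *)
Lemma closed_sumE (a : nat -> R -> R) (b r : R) (N : nat) (d : nat -> R) :
  (forall j, d j = 2 ^+ j * (expR (r ^+ 2 - b) * bintrans (a ^~ (r ^+ 2)) j)) ->
  expR (b - r ^+ 2) * (\sum_(j < N.+1) 'C(N, j)%:R * (-2) ^- j * d j)
    = a N (r ^+ 2).
Proof.
move=> dE; rewrite -[RHS](bintransK (a ^~ (r ^+ 2))) mulr_sumr.
apply: eq_bigr => j _.
have e1 : expR (b - r ^+ 2) * expR (r ^+ 2 - b) = 1.
  by rewrite -expRD addrA subrK subrr expR0.
rewrite dE; transitivity (expR (b - r ^+ 2) * expR (r ^+ 2 - b) *
  ('C(N, j)%:R * (-1) ^+ j * bintrans (a ^~ (r ^+ 2)) j)); last by rewrite e1 mul1r.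
have -> : (-2) ^- j = (-1) ^+ j * 2 ^- j :> R.
  rewrite (_ : -2 = -1 * 2) ?exprMn ?invfM; last by ring.
  congr (_ * _); by rewrite -exprVn invrN1.
by field; rewrite expf_neq0.
Qed.

Lemma closed_even (N : nat) (x0 r : R) : 0 < r ->
  expR (x0 ^+ 2 - r ^+ 2) * (\sum_(j < N.+1) 'C(N, j)%:R * (-2) ^- j
     * D_r j (fun s => cos (2 * x0 * s)) r) = al N x0 (r ^+ 2).
Proof.
move=> r0; have h n (s : R) : 0 < s -> is_derive s (1 : R) (al n x0) (- al n.+1 x0 s).
  by move=> s0; case: (albe_derive n x0 s0).
rewrite (closed_sumE (a := fun n => al n x0) (b := x0 ^+ 2) (r := r) N
  (d := fun j => D_r j (fun s => cos (2 * x0 * s)) r)) // => j.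
rewrite (D_r_comp_sqr (expR_bintrans_derive (x0 ^+ 2) h)) // => t t0.
rewrite /bintrans big_ord1 /= bin0 expr0 !mul1r /al /= /al0 mulrA -expRD addrA subrK.
by rewrite subrr expR0 mul1r sqrtr_sqr gtr0_norm.
Qed.

Lemma closed_odd (N : nat) (x0 r : R) : 0 < r ->
  expR (x0 ^+ 2 - r ^+ 2) * (\sum_(j < N.+1) 'C(N, j)%:R * (-2) ^- j
     * D_up j (fun s => sin (2 * x0 * s)) r) = r * be N x0 (r ^+ 2).
Proof.
move=> r0; have h n (s : R) : 0 < s -> is_derive s (1 : R) (be n x0) (- be n.+1 x0 s).
  by move=> s0; case: (albe_derive n x0 s0).
(* [D_up] produces an extra factor [r], divided out here so that the summands fit [closed_sumE]. *)
rewrite -(closed_sumE (a := fun n => be n x0) (b := x0 ^+ 2) (r := r) N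
  (d := fun j => r^-1 * D_up j (fun s => sin (2 * x0 * s)) r)).
  rewrite [RHS]mulrCA; congr (_ * _); rewrite mulr_sumr; apply: eq_bigr => j _.
  by rewrite [r * _]mulrCA mulVKf // gt_eqF.
move=> j; rewrite (D_up_mul_comp_sqr (expR_bintrans_derive (x0 ^+ 2) h)) //.
  by rewrite mulKf // gt_eqF.
move=> t t0.
rewrite /bintrans big_ord1 /= bin0 expr0 !mul1r /be /= /be0 mulrA -expRD addrA subrK.
by rewrite subrr expR0 mul1r sqrtr_sqr gtr0_norm // [RHS]mulrC divfK // gt_eqF.
Qed.

End ClosedForm.

(** * Left multiplication by vectors in the Clifford algebra *)

Section CliffordAction.
Set Implicit Arguments.
Unset Strict Implicit.
Variables (R : realType) (m : nat).
Local Notation clif := (clif R m).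
Implicit Types (a b : clif) (j k : 'I_m) (A B D : {set 'I_m}).

Lemma cadd_app a b A : (a + b) A = a A + b A.
Proof. by rewrite ffunE. Qed.

Lemma cscale_app (c : R) a A : (c *: a) A = c * a A.
Proof. by rewrite ffunE. Qed.

Lemma csum_app (I : Type) (r : seq I) (p : pred I) (F : I -> clif) A :
  (\sum_(i <- r | p i) F i) A = \sum_(i <- r | p i) F i A.
Proof. by rewrite sum_ffunE. Qed.

Lemma cmul_app a b D :
  cmul a b D = \sum_A \sum_B a A * b B * csign R A B * (D == csymdiff A B)%:R.
Proof.
rewrite /cmul csum_app; apply: eq_bigr => A _; rewrite csum_app.
by apply: eq_bigr => B _; rewrite cscale_app ffunE.
Qed.

Lemma cmulDl a b c : cmul (a + b) c = cmul a c + cmul b c.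
Proof.
apply/ffunP => D; rewrite cadd_app !cmul_app -big_split /=.
apply: eq_bigr => A _; rewrite -big_split; apply: eq_bigr => B _ /=.
by rewrite cadd_app !mulrDl.
Qed.

Lemma cmulZl (c : R) a b : cmul (c *: a) b = c *: cmul a b.
Proof.
apply/ffunP => D; rewrite cscale_app !cmul_app mulr_sumr.
apply: eq_bigr => A _; rewrite mulr_sumr; apply: eq_bigr => B _.
by rewrite cscale_app !mulrA.
Qed.

Lemma cmul0l b : cmul 0 b = 0.
Proof. by rewrite -{1}(scale0r (0 : clif)) cmulZl scale0r. Qed.

Lemma cmul_suml (I : finType) (F : I -> clif) b :
  cmul (\sum_i F i) b = \sum_i cmul (F i) b.
Proof.
elim: (index_enum I) => [|i r IH]; first by rewrite !big_nil cmul0l.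
by rewrite !big_cons cmulDl IH.
Qed.

(* Turning the sign into a product over indices makes the effect of adding or
   removing one index a single factor. *)
Definition sgb (b : bool) : R := (-1) ^+ b.

Lemma sgb_addb (b c : bool) : sgb (b (+) c) = sgb b * sgb c.
Proof. by rewrite /sgb signr_addb. Qed.

Lemma in_csymdiff1 k A j : (j \in csymdiff [set k] A) = (j == k) (+) (j \in A).
Proof. by rewrite !inE; case: (j == k); case: (j \in A). Qed.

Lemma csymdiff1K k A : csymdiff [set k] (csymdiff [set k] A) = A.
Proof. by apply/setP => j; rewrite !in_csymdiff1 addKb. Qed.

Lemma csymdiff1C j k A :
  csymdiff [set j] (csymdiff [set k] A) = csymdiff [set k] (csymdiff [set j] A).
Proof. by apply/setP => i; rewrite !in_csymdiff1 addbCA. Qed.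

Lemma csign1E k B :
  csign R [set k] B = (\prod_b sgb ((b \in B) && (b < k)%N)) * sgb (k \in B).
Proof.
rewrite /csign exprD; congr (_ * _); last first.
  congr (_ ^+ _); rewrite -[RHS]/(nat_of_bool (k \in B)); case: (boolP (k \in B)) => kB.
    have -> : [set k] :&: B = [set k] by apply/finset.setIidPl; rewrite finset.sub1set.
    by rewrite cards1.
  by apply/eqP; rewrite cards_eq0 finset.setI_eq0 disjoints1.
rewrite prodrXr; congr (_ ^+ _).
rewrite -sum1_card (eq_bigl (fun p => (p.1 == k) && ((p.2 \in B) && (p.2 < k)%N))).
  rewrite -(pair_big_dep (fun i => i == k) (fun i l => (l \in B) && (l < k)%N)
    (fun _ _ => 1%N)) /= big_pred1_eq big_mkcond /=.
  by apply: eq_bigr => b _; case: ifP.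
by move=> [i b]; rewrite !inE /=; case: eqP => [->|].
Qed.

Lemma csign1_csymdiff1 j k B : csign R [set j] (csymdiff [set k] B) =
  csign R [set j] B * sgb (k < j)%N * sgb (j == k).
Proof.
rewrite !csign1E in_csymdiff1 sgb_addb.
have -> : \prod_b sgb ((b \in csymdiff [set k] B) && (b < j)%N) =
    (\prod_b sgb ((b \in B) && (b < j)%N)) * sgb (k < j)%N.
  under eq_bigr do rewrite in_csymdiff1 andb_addl sgb_addb.
  rewrite big_split /= mulrC; congr (_ * _).
  rewrite (bigD1 k) //= eqxx big1 ?mulr1 // => b bk.
  by rewrite (negbTE bk).
by ring.
Qed.

Lemma csign_sqr A B : csign R A B * csign R A B = 1.
Proof. by rewrite /csign -expr2 sqrr_sign. Qed.

Definition emul k a : clif := cmul (cbasis R [set k]) a.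

(** Toggling the membership of [k] is an involution on index sets, so a single pair of basis
    elements contributes to each coordinate: [e_k] acts as a signed permutation. *)
Lemma emulE k a D :
  emul k a D = csign R [set k] (csymdiff [set k] D) * a (csymdiff [set k] D).
Proof.
rewrite /emul cmul_app (bigD1 [set k]) //= [X in _ + X]big1 ?addr0; last first.
  move=> A Ak; apply: big1 => B _; rewrite ffunE (negbTE Ak) !mul0r //.
rewrite (bigD1 (csymdiff [set k] D)) //= big1 ?addr0; last first.
  move=> B Bk; rewrite ffunE eqxx (_ : (D == _) = false) ?mulr0 //.
  by apply/negbTE; apply: contra Bk => /eqP ->; rewrite csymdiff1K.
by rewrite csymdiff1K ffunE !eqxx mul1r mulr1 mulrC.
Qed.

Lemma emulD k a b : emul k (a + b) = emul k a + emul k b.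
Proof. by apply/ffunP => D; rewrite !(cadd_app, emulE) mulrDr. Qed.

Lemma emulZ k (c : R) a : emul k (c *: a) = c *: emul k a.
Proof. by apply/ffunP => D; rewrite !(cscale_app, emulE) mulrCA. Qed.

Lemma emul0 k : emul k 0 = 0.
Proof. by apply/ffunP => D; rewrite emulE !ffunE mulr0. Qed.

Lemma emul_sum (I : finType) k (F : I -> clif) :
  emul k (\sum_i F i) = \sum_i emul k (F i).
Proof.
elim: (index_enum I) => [|i r IH]; first by rewrite !big_nil emul0.
by rewrite !big_cons emulD IH.
Qed.

(** For distinct indices the two orders carry the same signs except for [sgb (j < k)] against
    [sgb (k < j)], which are opposite; for equal indices the signs square to 1 and one factor -1 is
    left. *)
Lemma emul_anticomm j k a :
  emul j (emul k a) + emul k (emul j a) = (-2 * (j == k)%:R) *: a.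
Proof.
apply/ffunP => D; rewrite cadd_app cscale_app !emulE.
rewrite (csymdiff1C k j) !csign1_csymdiff1 !eqxx !ltnn.
have [->|jk] := eqVneq j k.
  rewrite csymdiff1K ltnn /sgb /= expr1 expr0 !mulr1.
  by have := csign_sqr [set k] D; move: (csign _ _ _) => c cc; ring: cc.
rewrite /sgb /= expr0 expr1 mulr0 mul0r !mulr1.
have [lt|gt|e] := ltngtP j k; rewrite ?expr0 ?expr1; try ring.
by move: jk; rewrite (val_inj e) eqxx.
Qed.

Lemma cmul1l a : cmul (cone1 R m) a = a.
Proof.
apply/ffunP => D; rewrite cmul_app (bigD1 finset.set0) //=.
rewrite [X in _ + X]big1 ?addr0; last first.
  by move=> A A0; apply: big1 => B _; rewrite ffunE (negbTE A0) !mul0r.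
have sd0 B : csymdiff finset.set0 B = B.
  by rewrite /csymdiff finset.set0D finset.setD0 finset.set0U.
rewrite (bigD1 D) //= big1 ?addr0; last first.
  by move=> B BD; rewrite sd0 eq_sym (negbTE BD) mulr0.
rewrite sd0 ffunE !eqxx mul1r mulr1 /csign.
rewrite finset.set0I cards0 addn0 (_ : finset _ = finset.set0) ?cards0 ?mulr1 //.
by apply/setP => p; rewrite !inE.
Qed.

Definition xmul (x : vec R m) a : clif := \sum_j xcoord x j *: emul j a.

Lemma cmul_comega (u v : R) (x : vec R m) a :
  cmul (u *: cone1 R m + v *: comega x) a = u *: a + (v / rnorm x) *: xmul x a.
Proof.
rewrite cmulDl !cmulZl cmul1l scalerA; congr (_ + _ *: _).
by rewrite /cvec cmul_suml; apply: eq_bigr => j _; rewrite cmulZl.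
Qed.

End CliffordAction.

(** * Dirac operator on radial multiples of monogenic polynomials *)

Section PartialDerivatives.
Set Implicit Arguments.
Unset Strict Implicit.
Variables (R : realType) (m : nat).
Local Notation clif := (clif R m).
Local Notation vec := (vec R m).
Local Notation unitv := (unitv R).
Implicit Types (f g : vec -> R) (G H : vec -> clif) (j k l : 'I_m) (x y : vec).

(** The relational form asserts differentiability together with the value, whereas [derive1] in
    [cpartial] is total. *)
Definition is_partial j f x (d : R) : Prop :=
  is_derive (0 : R) (1 : R) (fun t : R => f (x + t *: unitv j)) d.

Definition is_cpartial j G x (D : clif) : Prop :=
  forall A, is_partial j (fun y => G y A) x (D A).

Definition nsq x : R := \sum_j xcoord x j ^+ 2.

Lemma line0 x j : x + (0 : R) *: unitv j = x.
Proof. by rewrite scale0r addr0. Qed.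

Lemma xcoord_line x (t : R) i j :
  xcoord (x + t *: unitv j) i = xcoord x i + t * (i == j)%:R.
Proof. by rewrite /xcoord !mxE eqxx. Qed.

Lemma is_partial_val j f x (a b : R) :
  is_partial j f x a -> a = b -> is_partial j f x b.
Proof. by move=> + <-. Qed.

Lemma is_partialD j f g x (a b : R) : is_partial j f x a -> is_partial j g x b ->
  is_partial j (fun y => f y + g y) x (a + b).
Proof. exact: is_derive1D. Qed.

Lemma is_partialM j f g x (a b : R) : is_partial j f x a -> is_partial j g x b ->
  is_partial j (fun y => f y * g y) x (a * g x + f x * b).
Proof.
move=> fa gb; rewrite /is_partial.
by have := is_derive1M fa gb; rewrite !line0.
Qed.

Lemma is_partialC j (c : R) x : is_partial j (fun=> c) x 0.
Proof. exact: is_derive1C. Qed.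

Lemma is_partialZ j (c : R) f x (a : R) : is_partial j f x a ->
  is_partial j (fun y => c * f y) x (c * a).
Proof. exact: is_derive1Z. Qed.

Lemma is_partial_sum (I : finType) j (h : I -> vec -> R) (dh : I -> R) x :
  (forall i, is_partial j (h i) x (dh i)) ->
  is_partial j (fun y => \sum_i h i y) x (\sum_i dh i).
Proof. exact: is_derive1_sum. Qed.

Lemma is_partial_xcoord j i x : is_partial j (fun y => xcoord y i) x (i == j)%:R.
Proof.
rewrite /is_partial; under eq_fun do rewrite xcoord_line.
have h := is_derive1D (is_derive1C (xcoord x i) 0)
  (is_derive1M (is_derive_id (0 : R) (1 : R)) (is_derive1C (i == j)%:R 0)).
by apply: is_derive1_val h _; rewrite add0r mul1r mul0r addr0.
Qed.

Lemma is_partial_nsq j x : is_partial j nsq x (2 * xcoord x j).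
Proof.
apply: is_partial_val (is_partial_sum (fun i =>
  is_partialM (is_partial_xcoord j i x) (is_partial_xcoord j i x))) _.
rewrite (bigD1 j) //= big1 ?addr0 => [|i /negbTE ->].
  by rewrite eqxx mul1r mulr1 mulr_natl mulr2n.
by rewrite mul0r mulr0 addr0.
Qed.

Lemma is_partial_comp_nsq (phi : R -> R) (d : R) j x :
  is_derive (nsq x) (1 : R) phi d ->
  is_partial j (fun y => phi (nsq y)) x (d * (2 * xcoord x j)).
Proof.
move=> h; rewrite -(line0 x j) in h.
exact: (@is_derive1_comp _ phi (fun t => nsq (x + t *: unitv j))
  _ _ _ h (is_partial_nsq j x)).
Qed.

(** Moves the base point of the line: a partial derivative is taken at parameter 0, while a second
    derivative needs the first one at all nearby parameters. *)
Lemma is_derive_line j f x (t d : R) : is_partial j f (x + t *: unitv j) d ->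
  is_derive t (1 : R) (fun u => f (x + u *: unitv j)) d.
Proof.
move=> h; have h' : is_derive (t - t) (1 : R)
    (fun u => f (x + t *: unitv j + u *: unitv j)) d by rewrite subrr.
have hs := is_derive1B (is_derive_id t (1 : R)) (is_derive1C t t).
have := @is_derive1_comp _ _ (fun u => u - t) _ _ _ h' hs.
rewrite subr0 mulr1 (_ : _ \o _ = fun u => f (x + u *: unitv j)) //.
by apply/funext => u /=; rewrite -addrA -scalerDl [t + _]addrC subrK.
Qed.

Lemma is_cpartial_cpartial j G x D : is_cpartial j G x D -> cpartial j G x = D.
Proof.
by move=> h; apply/ffunP => A; rewrite ffunE derive1E; case: (h A).
Qed.

Lemma is_cpartial_uniq j G x C D :
  is_cpartial j G x C -> is_cpartial j G x D -> C = D.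
Proof. by move=> /is_cpartial_cpartial <- /is_cpartial_cpartial. Qed.

Lemma is_cpartial_emul k j G x D :
  is_cpartial j G x D -> is_cpartial j (fun y => emul k (G y)) x (emul k D).
Proof.
move=> h A; rewrite emulE; under eq_fun do rewrite emulE.
exact: is_partialZ.
Qed.

Lemma is_cpartialD j G H x C D : is_cpartial j G x C -> is_cpartial j H x D ->
  is_cpartial j (fun y => G y + H y) x (C + D).
Proof.
move=> gC hD A; rewrite cadd_app; under eq_fun do rewrite cadd_app.
exact: is_partialD.
Qed.

Lemma is_cpartialC j (c : clif) x : is_cpartial j (fun=> c) x 0.
Proof. by move=> A; rewrite ffunE; exact: is_partialC. Qed.

Lemma is_cpartial_sum (I : finType) j (G : I -> vec -> clif) (D : I -> clif) x :
  (forall i, is_cpartial j (G i) x (D i)) ->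
  is_cpartial j (fun y => \sum_i G i y) x (\sum_i D i).
Proof.
move=> h A; rewrite csum_app; under eq_fun do rewrite csum_app.
by apply: is_partial_sum => i; exact: h.
Qed.

Lemma is_cpartial_scale j f G x (a : R) D :
  is_partial j f x a -> is_cpartial j G x D ->
  is_cpartial j (fun y => f y *: G y) x (a *: G x + f x *: D).
Proof.
move=> fa GD A; rewrite cadd_app !cscale_app.
under eq_fun do rewrite cscale_app.
exact: is_partialM.
Qed.

(** Symmetry of mixed partials and Euler's identity are stable under sums and products, so carrying
    explicit partials yields both by induction on the construction of a polynomial. *)
Definition smooth_homog (d : nat) f := exists f1 : 'I_m -> vec -> R,
  exists f2 : 'I_m -> 'I_m -> vec -> R,
  [/\ forall j y, is_partial j f y (f1 j y),
      forall j l y, is_partial l (f1 j) y (f2 j l y),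
      forall j l y, f2 j l y = f2 l j y &
      forall y, \sum_j xcoord y j * f1 j y = d%:R * f y].

Lemma smooth_homog0 d : smooth_homog d (fun=> 0).
Proof.
exists (fun _ _ => 0), (fun _ _ _ => 0); split => // [j y|j l y|y].
- exact: is_partialC.
- exact: is_partialC.
- by rewrite big1 ?mulr0 // => j _; rewrite mulr0.
Qed.

Lemma smooth_homogC (c : R) : smooth_homog 0 (fun=> c).
Proof.
exists (fun _ _ => 0), (fun _ _ _ => 0); split => // [j y|j l y|y].
- exact: is_partialC.
- exact: is_partialC.
- by rewrite mul0r big1 // => j _; rewrite mulr0.
Qed.

Lemma smooth_homog_xcoord i : smooth_homog 1 (fun y => xcoord y i).
Proof.
exists (fun j _ => (i == j)%:R), (fun _ _ _ => 0); split => // [j y|j l y|y].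
- exact: is_partial_xcoord.
- exact: is_partialC.
- rewrite mul1r (bigD1 i) //= eqxx mulr1 big1 ?addr0 // => j ji.
  by rewrite eq_sym (negbTE ji) mulr0.
Qed.

Lemma smooth_homogD d f g :
  smooth_homog d f -> smooth_homog d g -> smooth_homog d (fun y => f y + g y).
Proof.
move=> [f1 [f2 [hf1 hf2 fs fe]]] [g1 [g2 [hg1 hg2 gs ge]]].
exists (fun j y => f1 j y + g1 j y), (fun j l y => f2 j l y + g2 j l y).
split => [j y|j l y|j l y|y].
- exact: is_partialD.
- exact: is_partialD.
- by rewrite fs gs.
- by under eq_bigr do rewrite mulrDr; rewrite big_split /= fe ge mulrDr.
Qed.

Lemma smooth_homogM d e f g :
  smooth_homog d f -> smooth_homog e g -> smooth_homog (d + e) (fun y => f y * g y).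
Proof.
move=> [f1 [f2 [hf1 hf2 fs fe]]] [g1 [g2 [hg1 hg2 gs ge]]].
exists (fun j y => f1 j y * g y + f y * g1 j y).
exists (fun j l y => (f2 j l y * g y + f1 j y * g1 l y)
                     + (f1 l y * g1 j y + f y * g2 j l y)).
split => [j y|j l y|j l y|y].
- exact: is_partialM.
- by apply: is_partialD; exact: is_partialM.
- by rewrite fs gs; ring.
- under eq_bigr do rewrite mulrDr mulrA [xcoord y _ * (f y * _)]mulrCA.
  by rewrite big_split /= -mulr_suml -mulr_sumr fe ge natrD; ring.
Qed.

Lemma smooth_homogX d f n : smooth_homog d f -> smooth_homog (n * d) (fun y => f y ^+ n).
Proof.
move=> h; elim: n => [|n IH]; first exact: smooth_homogC.
under eq_fun do rewrite exprS.
exact: smooth_homogM.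
Qed.

Lemma homog_poly_smooth d f : homog_poly d f -> smooth_homog d f.
Proof.
move=> [c /funext ->].
have hm (a : {ffun 'I_m -> 'I_d.+1}) (r : seq 'I_m) : smooth_homog (\sum_(j <- r) a j)
    (fun x => \prod_(j <- r) xcoord x j ^+ a j).
  elim: r => [|i r IH].
    rewrite big_nil (_ : (fun x => _) = fun=> 1); first exact: smooth_homogC.
    by apply/funext => x; rewrite big_nil.
  rewrite (_ : (fun x => _) = fun x => xcoord x i ^+ a i *
    \prod_(j <- r) xcoord x j ^+ a j); last first.
    by apply/funext => x; rewrite big_cons.
  rewrite big_cons -[X in (X + _)%N]muln1; apply: smooth_homogM IH.
  by apply: smooth_homogX; exact: smooth_homog_xcoord.
elim: (index_enum _) => [|a r IH].
  rewrite (_ : (fun x => _) = fun=> 0); first exact: smooth_homog0.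
  by apply/funext => x; rewrite big_nil.
case: (boolP (\sum_j (a j : nat) == d)%N) => ad; last first.
  rewrite (_ : (fun x => _) = fun x => \sum_(a <- r | (\sum_j (a j : nat) == d)%N)
     c a * \prod_j xcoord x j ^+ a j) //.
  by apply/funext => x; rewrite big_cons (negbTE ad).
rewrite (_ : (fun x => _) = fun x => c a * (\prod_j xcoord x j ^+ a j) +
  \sum_(a <- r | (\sum_j (a j : nat) == d)%N) c a * \prod_j xcoord x j ^+ a j); last first.
  by apply/funext => x; rewrite big_cons ad.
apply: smooth_homogD => //.
have := smooth_homogM (smooth_homogC (c a)) (hm a (index_enum _)).
by rewrite add0n (eqP ad).
Qed.

Definition harmonic_homog (d : nat) G := exists G1 G2 : 'I_m -> vec -> clif,
  [/\ forall j y, is_cpartial j G y (G1 j y),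
      forall j y, is_cpartial j (G1 j) y (G2 j y),
      forall y, \sum_j G2 j y = 0 &
      forall y, \sum_j xcoord y j *: G1 j y = d%:R *: G y].

(** Doubling the double sum and exchanging the indices in one copy forms anticommutators, of which
    the diagonal alone survives. *)
Lemma xmulK x (a : clif) : xmul x (xmul x a) = - nsq x *: a.
Proof.
rewrite /xmul; under eq_bigr do rewrite emul_sum scaler_sumr.
under eq_bigr do under eq_bigr do rewrite emulZ scalerA.
apply: (scalerI (_ : 2 != 0 :> R)) => //.
rewrite scaler_nat mulr2n {2}exchange_big -big_split /= scalerA mulrN -mulNr.
rewrite mulr_sumr scaler_suml; apply: eq_bigr => j _.
rewrite -big_split /= (bigD1 j) //= big1 ?addr0 => [|i ij].
  by rewrite -scalerDr emul_anticomm eqxx scalerA mulr1 mulrC.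
rewrite [xcoord x i * _]mulrC -scalerDr emul_anticomm eq_sym (negbTE ij).
by rewrite mulr0 scale0r scaler0.
Qed.

(** * Harmonicity and Dirac formulas for a monogenic polynomial *)

Section Monogenic.
Variables (d : nat) (P : vec -> clif).
Hypothesis P_homog : forall A, homog_poly d (fun y => P y A).
Hypothesis P_monogenic : forall y, Dirac P y = 0.

Lemma monogenic_partials : exists P1 : 'I_m -> vec -> clif,
  exists P2 : 'I_m -> 'I_m -> vec -> clif,
  [/\ forall j y, is_cpartial j P y (P1 j y),
      forall j l y, is_cpartial l (P1 j) y (P2 j l y),
      forall j l y, P2 j l y = P2 l j y &
      forall y, \sum_j xcoord y j *: P1 j y = d%:R *: P y].
Proof.
have [f1 h1] := choice (fun A => homog_poly_smooth (P_homog A)).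
have [f2 h2] := choice h1.
exists (fun j y => [ffun A => f1 A j y]), (fun j l y => [ffun A => f2 A j l y]).
split => [j y A|j l y A|j l y|y].
- by rewrite ffunE; case: (h2 A).
- rewrite ffunE; under eq_fun do rewrite ffunE.
  by case: (h2 A).
- by apply/ffunP => A; rewrite !ffunE; case: (h2 A).
- apply/ffunP => A; rewrite csum_app cscale_app; case: (h2 A) => _ _ _ <-.
  by apply: eq_bigr => j _; rewrite cscale_app ffunE.
Qed.

Lemma monogenic_partial_sum (P1 : 'I_m -> vec -> clif) y :
  (forall j y, is_cpartial j P y (P1 j y)) -> \sum_j emul j (P1 j y) = 0.
Proof.
move=> h; rewrite -[RHS](P_monogenic y); apply: eq_bigr => j _.
by rewrite (is_cpartial_cpartial (h j y)).
Qed.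

(** The square of the Dirac operator is minus the Laplacian: symmetry of the second partials and
    anticommutation reduce the double sum to its diagonal. *)
Lemma monogenic_harmonic : harmonic_homog d P.
Proof.
have [P1 [P2 [h1 h2 hs he]]] := monogenic_partials.
exists P1, (fun j => P2 j j); split => // y.
have D2 k : \sum_j emul j (P2 j k y) = 0.
  apply: (@is_cpartial_uniq k (fun y => \sum_j emul j (P1 j y)) y).
    by apply: is_cpartial_sum => j; exact: is_cpartial_emul.
  under eq_fun do rewrite monogenic_partial_sum //.
  exact: is_cpartialC.
apply: (scalerI (_ : -2 != 0 :> R)); first by rewrite oppr_eq0.
rewrite scaler0 scaler_sumr.
transitivity (\sum_k emul k (\sum_j emul j (P2 j k y)) +
              \sum_k emul k (\sum_j emul j (P2 j k y))); last first.
  by rewrite big1 ?addr0 // => k _; rewrite D2 emul0.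
under [X in _ = X + _]eq_bigr do rewrite emul_sum.
under [X in _ = _ + X]eq_bigr do rewrite emul_sum.
rewrite [X in _ = _ + X]exchange_big -big_split /=; apply: eq_bigr => k _.
rewrite -big_split /= (bigD1 k) //= [X in _ = _ + X]big1 ?addr0 => [|j jk].
  by rewrite emul_anticomm eqxx mulr1.
by rewrite hs emul_anticomm eq_sym (negbTE jk) mulr0 scale0r.
Qed.

Lemma xmul_monogenic_partials : exists P1 P2 : 'I_m -> vec -> clif,
  [/\ forall j y, is_cpartial j P y (P1 j y),
      forall j y, is_cpartial j (P1 j) y (P2 j y),
      forall j y, is_cpartial j (fun z => xmul z (P z)) y
        (emul j (P y) + xmul y (P1 j y)) &
      forall j y, is_cpartial j (fun z => emul j (P z) + xmul z (P1 j z)) y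
        (2 *: emul j (P1 j y) + xmul y (P2 j y))].
Proof.
have [P1 [P2 [h1 h2 hs he]]] := monogenic_partials.
have dx (F F' : vec -> clif) j y : is_cpartial j F y (F' y) ->
    is_cpartial j (fun z => xmul z (F z)) y (emul j (F y) + xmul y (F' y)).
  move=> hF; have := is_cpartial_sum (fun i => is_cpartial_scale
    (is_partial_xcoord j i y) (is_cpartial_emul i hF)).
  rewrite big_split /= (bigD1 j) //= eqxx scale1r big1 ?addr0 // => i /negbTE ->.
  by rewrite scale0r.
exists P1, (fun j => P2 j j); split => // j y; first exact: dx.
rewrite scaler_nat mulr2n -addrA; apply: is_cpartialD (dx _ _ _ _ _) => //.
exact: is_cpartial_emul.
Qed.

Lemma xmul_linear_sum (I : finType) y (F : I -> clif) :
  xmul y (\sum_i F i) = \sum_i xmul y (F i).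
Proof.
rewrite /xmul exchange_big /=; apply: eq_bigr => j _.
by rewrite emul_sum scaler_sumr.
Qed.

Lemma xmulZ y (c : R) (a : clif) : xmul y (c *: a) = c *: xmul y a.
Proof.
rewrite /xmul scaler_sumr; apply: eq_bigr => j _.
by rewrite emulZ !scalerA mulrC.
Qed.

Lemma xmul0 y : xmul y (0 : clif) = 0.
Proof. by rewrite -{1}(scale0r (0 : clif)) xmulZ scale0r. Qed.

(** The Laplacian of [xP] is [x] times that of [P] plus twice the Dirac derivative of [P], and both
    vanish. *)
Lemma xmul_monogenic_harmonic : harmonic_homog d.+1 (fun y => xmul y (P y)).
Proof.
have [G1 [G2 [g1 g2 hh he]]] := monogenic_harmonic.
have [P1 [P2 [h1 h2 q1 q2]]] := xmul_monogenic_partials.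
have e1 j y : P1 j y = G1 j y by exact: is_cpartial_uniq (h1 j y) (g1 j y).
have e2 j y : P2 j y = G2 j y.
  apply: is_cpartial_uniq (h2 j y) _.
  by rewrite (_ : P1 j = G1 j) //; apply/funext => z; rewrite e1.
exists (fun j y => emul j (P y) + xmul y (P1 j y)).
exists (fun j y => 2 *: emul j (P1 j y) + xmul y (P2 j y)).
split => // y.
  rewrite big_split /= -scaler_sumr monogenic_partial_sum // scaler0 add0r.
  by rewrite -xmul_linear_sum; under eq_bigr do rewrite e2; rewrite hh xmul0.
under eq_bigr do rewrite scalerDr -xmulZ.
rewrite big_split /= -xmul_linear_sum; under [X in xmul y X]eq_bigr do rewrite e1.
by rewrite he xmulZ -natr1 scalerDl scale1r addrC.
Qed.

Lemma Dirac_radial (phi : R -> R) (phi' : R) y :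
  is_derive (nsq y) (1 : R) phi phi' ->
  Dirac (fun z => phi (nsq z) *: P z) y = (2 * phi') *: xmul y (P y).
Proof.
move=> dphi; have [P1 [P2 [h1 _ _ _]]] := monogenic_partials.
transitivity ((2 * phi') *: xmul y (P y) + phi (nsq y) *: \sum_j emul j (P1 j y)); last first.
  by rewrite monogenic_partial_sum // scaler0 addr0.
rewrite /Dirac /xmul !scaler_sumr -big_split /=.
apply: eq_bigr => j _.
rewrite (is_cpartial_cpartial (is_cpartial_scale (is_partial_comp_nsq j dphi) (h1 j y))).
rewrite -/(emul j _) [LHS]emulD !emulZ scalerA.
by congr (_ *: _ + _); rewrite mulrCA mulrA.
Qed.

(** The term in [phi'] comes from [x^2 = - nsq x]. In the Dirac derivative of [xP] the squares
    [e_j^2 = -1] give [- m], and exchanging [x] with the Dirac operator gives [- 2d] through Euler's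
    identity. *)
Lemma Dirac_radial_xmul (phi : R -> R) (phi' : R) y :
  is_derive (nsq y) (1 : R) phi phi' ->
  Dirac (fun z => phi (nsq z) *: xmul z (P z)) y =
  - (2 * nsq y * phi' + (m + 2 * d)%:R * phi (nsq y)) *: P y.
Proof.
move=> dphi; have [P1 [P2 [h1 _ q1 _]]] := xmul_monogenic_partials.
have [G1 [G2 [g1 g2 hh he]]] := monogenic_harmonic.
have e1 j : P1 j y = G1 j y by exact: is_cpartial_uniq (h1 j y) (g1 j y).
have eP j (a : clif) : emul j (emul j a) = - a.
  have := emul_anticomm j j a; rewrite -mulr2n eqxx mulr1 scaleNr -scaler_nat.
  rewrite -scalerN => e; apply: (scalerI (_ : 2 != 0 :> R)) => //.
have -> : Dirac (fun z => phi (nsq z) *: xmul z (P z)) y =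
    (2 * phi') *: xmul y (xmul y (P y)) +
    phi (nsq y) *: \sum_j emul j (emul j (P y) + xmul y (P1 j y)).
  rewrite /Dirac [xmul y (xmul _ _)]/xmul !scaler_sumr -big_split /=.
  apply: eq_bigr => j _.
  rewrite (is_cpartial_cpartial (is_cpartial_scale (is_partial_comp_nsq j dphi) (q1 j y))).
  rewrite -/(emul j _) [LHS]emulD !emulZ scalerA.
  by congr (_ *: _ + _); rewrite mulrCA mulrA.
have -> : \sum_j emul j (emul j (P y) + xmul y (P1 j y)) = - (m + 2 * d)%:R *: P y.
  under eq_bigr do rewrite emulD eP.
  rewrite big_split /= sumr_const card_ord.
  have -> : \sum_j emul j (xmul y (P1 j y)) = - (2 * d)%:R *: P y.
    rewrite /xmul; under eq_bigr do rewrite emul_sum.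
    under eq_bigr do under eq_bigr do rewrite emulZ.
    (* The first sum is -2 times Euler's identity; the subtracted one is [x] times [Dirac P], hence
       zero, and completes the anticommutators. *)
    have -> : - (2 * d)%:R *: P y =
        \sum_j \sum_i (xcoord y i * (-2 * (j == i)%:R)) *: P1 j y
        - \sum_i xcoord y i *: emul i (\sum_j emul j (P1 j y)).
      rewrite monogenic_partial_sum //.
      under [X in _ - X]eq_bigr do rewrite emul0 scaler0.
      rewrite big1_eq subr0 natrM -mulNr -scalerA -he scaler_sumr.
      apply: eq_bigr => j _; rewrite (bigD1 j) //= eqxx mulr1 big1 ?addr0 => [|i ij].
        by rewrite e1 scalerA mulrC.
      by rewrite eq_sym (negbTE ij) !mulr0 scale0r.
    under [X in _ - X]eq_bigr do rewrite emul_sum scaler_sumr.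
    rewrite [X in _ - X]exchange_big -sumrB; apply: eq_bigr => j _.
    rewrite -sumrB; apply: eq_bigr => i _.
    by rewrite -scalerA -emul_anticomm scalerDr addrK.
  by rewrite natrD opprD scalerDl; congr (_ + _); rewrite scaleNr scaler_nat mulNrn.
rewrite xmulK !scalerA -scalerDl; congr (_ *: _); ring.
Qed.

End Monogenic.

End PartialDerivatives.

(** * Laplacian on radial multiples of harmonic polynomials *)

Section RadialLaplacian.
Set Implicit Arguments.
Unset Strict Implicit.
Variable R : realType.
Implicit Types f g : R -> R.

(** The first derivative is asked for near [t] only, since radial factors are controlled only away
    from the origin. *)
Definition is_second_derive f (t d : R) : Prop := exists f1 : R -> R,
  (\forall u \near t, is_derive u (1 : R) f (f1 u)) /\
  is_derive t (1 : R) f1 d.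

Lemma is_second_derive_val f (t d : R) :
  is_second_derive f t d -> derive1 (derive1 f) t = d.
Proof.
move=> [f1 [nf h]]; rewrite derive1E.
have h' : is_derive t (1 : R) (derive1 f) d.
  apply: near_eq_is_derive h; near=> u; rewrite derive1E.
  have : is_derive u (1 : R) f (f1 u) by near: u.
  by case.
by case: h'.
Unshelve. all: by end_near. Qed.

Lemma is_second_deriveD f g (t a b : R) :
  is_second_derive f t a -> is_second_derive g t b ->
  is_second_derive (fun u => f u + g u) t (a + b).
Proof.
move=> [f1 [nf hf]] [g1 [ng hg]]; exists (fun u => f1 u + g1 u); split.
  near=> u; apply: is_derive1D; by near: u.
exact: is_derive1D.
Unshelve. all: by end_near. Qed.

Lemma is_second_deriveZ f (c t a : R) :
  is_second_derive f t a -> is_second_derive (fun u => c * f u) t (c * a).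
Proof.
move=> [f1 [nf hf]]; exists (fun u => c * f1 u); split.
  near=> u; apply: is_derive1Z; by near: u.
exact: is_derive1Z.
Unshelve. all: by end_near. Qed.

Lemma is_second_derive_near f g (t d : R) : {near t, f =1 g} ->
  is_second_derive f t d -> is_second_derive g t d.
Proof.
move=> /near_join fg [f1 [nf hf]]; exists f1; split => //.
near=> u; apply: (near_eq_is_derive (f := f)); by near: u.
Unshelve. all: by end_near. Qed.

Variable m : nat.
Local Notation clif := (clif R m).
Local Notation vec := (vec R m).
Local Notation unitv := (unitv R).
Implicit Types (x y : vec) (j : 'I_m).

Lemma nsq_gt0 x : (0 < nsq x) = (x != 0).
Proof.
apply/idP/idP => [|x0].
  apply: contraTneq => ->; rewrite /nsq big1 ?ltxx // => j _.
  by rewrite /xcoord mxE expr0n.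
rewrite lt_def sumr_ge0 ?andbT => [|j _]; last exact: sqr_ge0.
apply: contra x0 => /eqP /psumr_eq0P h; apply/eqP/rowP => j; rewrite mxE.
by apply/eqP; rewrite -sqrf_eq0; apply/eqP/h => // i _; exact: sqr_ge0.
Qed.

Lemma sqr_rnorm x : rnorm x ^+ 2 = nsq x.
Proof. by rewrite sqr_sqrtr // sumr_ge0 // => j _; exact: sqr_ge0. Qed.

Lemma near_line_neq0 x j : x != 0 ->
  \forall t \near (0 : R), x + t *: unitv j != 0.
Proof.
move=> x0.
have cont : {for (0 : R), continuous (fun t : R => nsq (x + t *: unitv j))}.
  by apply/differentiable_continuous/derivable1_diffP; case: (is_partial_nsq j x).
have pos : 0 < nsq (x + (0 : R) *: unitv j) by rewrite line0 nsq_gt0.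
by near=> t; rewrite -nsq_gt0; near: t; exact: cvgr_gt cont _ pos.
Unshelve. all: by end_near. Qed.

Section Radial.
Variables phi phi1 phi2 : R -> R.
Hypothesis phi_derive : forall s : R, 0 < s -> is_derive s (1 : R) phi (phi1 s).
Hypothesis phi1_derive : forall s : R, 0 < s -> is_derive s (1 : R) phi1 (phi2 s).

Lemma radial_second_derive (f f1 f2 : vec -> R) j x :
  (forall y, is_partial j f y (f1 y)) -> (forall y, is_partial j f1 y (f2 y)) ->
  x != 0 ->
  is_second_derive (fun t => phi (nsq (x + t *: unitv j)) * f (x + t *: unitv j)) 0
    (4 * phi2 (nsq x) * xcoord x j ^+ 2 * f x + 2 * phi1 (nsq x) * f x
     + 4 * phi1 (nsq x) * (xcoord x j * f1 x) + phi (nsq x) * f2 x).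
Proof.
move=> h1 h2 x0; pose g y := phi1 (nsq y) * (2 * xcoord y j) * f y + phi (nsq y) * f1 y.
exists (fun t => g (x + t *: unitv j)); split.
  near=> t.
  apply: (@is_derive_line _ _ j (fun y => phi (nsq y) * f y)).
  apply: is_partialM (h1 _); apply: is_partial_comp_nsq; apply: phi_derive.
  by rewrite nsq_gt0; near: t; exact: near_line_neq0.
have s0 : 0 < nsq x by rewrite nsq_gt0.
have dg : is_partial j g x _ := is_partialD (is_partialM (is_partialM
  (is_partial_comp_nsq j (phi1_derive s0))
  (is_partialZ 2 (is_partial_xcoord j j x))) (h1 x))
  (is_partialM (is_partial_comp_nsq j (phi_derive s0)) (h2 x)).
apply: is_derive1_val dg _.
by rewrite eqxx -[true%:R]/(1 : R); ring.
Unshelve. all: by end_near. Qed.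

(** Euler's identity evaluates the cross term and harmonicity removes the last one. The directional
    derivatives are returned separately so that those of two such fields can be added. *)
Lemma radial_laplacian (d : nat) (G : vec -> clif) x A :
  harmonic_homog d G -> x != 0 ->
  exists D : 'I_m -> R,
    (forall j, is_second_derive
       (fun t => phi (nsq (x + t *: unitv j)) * G (x + t *: unitv j) A) 0 (D j)) /\
    \sum_j D j =
      (4 * nsq x * phi2 (nsq x) + (2 * (m + 2 * d)%:R) * phi1 (nsq x)) * G x A.
Proof.
move=> [G1 [G2 [h1 h2 hh he]]] x0.
exists (fun j => 4 * phi2 (nsq x) * xcoord x j ^+ 2 * G x A + 2 * phi1 (nsq x) * G x A
     + 4 * phi1 (nsq x) * (xcoord x j * G1 j x A) + phi (nsq x) * G2 j x A).
split=> [j|].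
  exact: (@radial_second_derive (fun y => G y A) (fun y => G1 j y A)
    (fun y => G2 j y A) j x (fun y => h1 j y A) (fun y => h2 j y A) x0).
rewrite !big_split /= -!mulr_sumr -!mulr_suml -mulr_sumr -/(nsq x).
have -> : \sum_j xcoord x j * G1 j x A = d%:R * G x A.
  rewrite -cscale_app -he csum_app; apply: eq_bigr => j _.
  by rewrite cscale_app.
have -> : \sum_j G2 j x A = 0 by rewrite -csum_app hh ffunE.
by rewrite sumr_const card_ord -mulr_natl natrD natrM; ring.
Qed.

End Radial.

(** * Iterated Laplacians and the Fueter map *)

Section Fueter.
Variables (k N : nat) (P : vec -> clif).
Hypothesis P_homog : forall A, homog_poly k (fun y => P y A).
Hypothesis P_monogenic : forall y, Dirac P y = 0.
Hypothesis N_def : (m + 2 * k = 2 * N + 1)%N.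

Definition albe_field n (x0 : R) x : clif :=
  al n x0 (nsq x) *: P x + be n x0 (nsq x) *: xmul x (P x).

(** The terms of index [n.+2] from the time and space derivatives cancel. At index [n.+1] there
    remains [2 (2n + 1) - 2 (m + 2k)] for [P] and [2 (2n + 3) - 2 (m + 2k + 2)] for [xP], both equal
    to [-4 (N - n)]. *)
Lemma lapl_albe_field n (c : R) (F : R -> vec -> clif) : (n <= N)%N ->
  (forall (y0 : R) y, y != 0 -> F y0 y = c *: albe_field n y0 y) ->
  forall (x0 : R) x, x != 0 ->
  lapl F x0 x = (c * (-4 * (N - n)%:R)) *: albe_field n.+1 x0 x.
Proof.
move=> nN FE x0 x xn0; have s0 : 0 < nsq x by rewrite nsq_gt0.
have FA (y0 : R) y A : y != 0 -> F y0 y A = c * (al n y0 (nsq y) * P y A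
    + be n y0 (nsq y) * xmul y (P y) A).
  by move=> yn0; rewrite FE // !(cscale_app, cadd_app).
apply/ffunP => A; rewrite ffunE.
have time : is_second_derive (fun t => F t x A) x0 (c *
   (P x A * (2 * ((2 * n%:R + 1) * al n.+1 x0 (nsq x) - 2 * nsq x * al n.+2 x0 (nsq x)))
    + xmul x (P x) A * (2 * ((2 * n.+1%:R + 1) * be n.+1 x0 (nsq x)
        - 2 * nsq x * be n.+2 x0 (nsq x))))).
  rewrite (_ : (fun t => F t x A) = fun t => c * (P x A * al n t (nsq x)
      + xmul x (P x) A * be n t (nsq x))); last first.
    by apply/funext => t; rewrite FA // [P x A * _]mulrC [xmul _ _ _ * _]mulrC.
  apply: is_second_deriveZ; apply: is_second_deriveD; apply: is_second_deriveZ.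
    exists (fun t => (2 * n%:R + 1) * be n t (nsq x) - 2 * nsq x * be n.+1 t (nsq x)).
    split; first by near=> t; case: (albe_derive n t s0).
    case: (albe_derive n x0 s0) => _ _ _ d1; case: (albe_derive n.+1 x0 s0) => _ _ _ d2.
    apply: is_derive1_val (is_derive1B (is_derive1Z (2 * n%:R + 1) d1)
      (is_derive1Z (2 * nsq x) d2)) _.
    by ring.
  exists (fun t => 2 * al n.+1 t (nsq x)).
  split; first by near=> t; case: (albe_derive n t s0).
  by apply: is_derive1Z; case: (albe_derive n.+1 x0 s0).
have d1a (s : R) : 0 < s -> is_derive s (1 : R) (al n x0) (- al n.+1 x0 s).
  by move=> /(albe_derive n x0) [].
have d1b (s : R) : 0 < s -> is_derive s (1 : R) (be n x0) (- be n.+1 x0 s).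
  by move=> /(albe_derive n x0) [].
have d2a (s : R) : 0 < s ->
    is_derive s (1 : R) (fun t => - al n.+1 x0 t) (al n.+2 x0 s).
  by move=> /(albe_derive n.+1 x0) [h _ _ _]; have := is_deriveN h; rewrite opprK.
have d2b (s : R) : 0 < s ->
    is_derive s (1 : R) (fun t => - be n.+1 x0 t) (be n.+2 x0 s).
  by move=> /(albe_derive n.+1 x0) [_ h _ _]; have := is_deriveN h; rewrite opprK.
have [D [hD sD]] := radial_laplacian d1a d2a A
  (monogenic_harmonic P_homog P_monogenic) xn0.
have [E [hE sE]] := radial_laplacian d1b d2b A
  (xmul_monogenic_harmonic P_homog P_monogenic) xn0.
have space j : is_second_derive (fun t => F x0 (x + t *: unitv j) A) 0
    (c * (D j + E j)).
  apply: is_second_derive_near (is_second_deriveZ c (is_second_deriveD (hD j) (hE j))).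
  near=> t; rewrite FA //; near: t; exact: near_line_neq0.
rewrite (is_second_derive_val time).
under eq_bigr do rewrite (is_second_derive_val (space _)).
rewrite -mulr_sumr big_split /= sD sE !(cscale_app, cadd_app) natrB //.
have -> : (m + 2 * k.+1)%:R = 2 * N%:R + 3 :> R.
  rewrite -natrM -natrD; congr _%:R.
  by rewrite mulnS addnCA N_def addnCA.
rewrite N_def natrD natrM -!natr1; ring.
Unshelve. all: by end_near. Qed.

Lemma iter_lapl n (F : R -> vec -> clif) : (n <= N)%N ->
  (forall (y0 : R) y, y != 0 -> F y0 y = albe_field 0 y0 y) ->
  forall (x0 : R) x, x != 0 ->
  iter n (@lapl R m) F x0 x = ((-4) ^+ n * (N ^_ n)%:R) *: albe_field n x0 x.
Proof.
move=> nN FE; elim: n nN => [|n IH] nN x0 x xn0 /=.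
  by rewrite ffactn0 mul1r scale1r FE.
rewrite (lapl_albe_field (ltnW nN) (IH (ltnW nN))) //; congr (_ *: _).
by rewrite ffactnSr natrM exprS; ring.
Qed.

Lemma dfact_double n : dfact (2 * n) = (2 ^ n * n`!)%N.
Proof.
elim: n => // n IH; rewrite mulnS [dfact _]/= -/(2 * n)%N.
by rewrite IH factS expnS; lia.
Qed.

(** After [N] Laplacians the constant is [(-4)^N N!], which is [(-2)^N (2N)!!] because
    [(2N)!! = 2^N N!]; and [2k + m - 1 = 2N]. *)
Lemma Fueter_albe (x0 : R) x : x != 0 -> N = (k + m.-1./2)%N ->
  ((-2) ^+ N * (dfact (2 * k + m - 1))%:R)^-1 *:
     Fueter k (fun a b => expR (a ^+ 2 - b ^+ 2) * cos (2 * a * b))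
              (fun a b => expR (a ^+ 2 - b ^+ 2) * sin (2 * a * b)) P x0 x
   = albe_field N x0 x.
Proof.
move=> xn0 NE; rewrite /Fueter -NE (iter_lapl (leqnn N)) //; last first.
  move=> y0 y yn0; rewrite cmul_comega /albe_field /al /be /= /al0 /be0.
  by rewrite sqr_rnorm; congr (_ + _ *: _); rewrite -[LHS]mulrA.
rewrite scalerA (_ : 2 * k + m - 1 = 2 * N)%N; last by rewrite addnC N_def addn1 subn1.
rewrite dfact_double ffactnn natrM natrX.
have -> : (-4) ^+ N = (-2) ^+ N * 2 ^+ N :> R by rewrite -exprMn; congr (_ ^+ _); ring.
by rewrite mulrA mulVf ?scale1r // !mulf_neq0 // ?expf_neq0 ?oppr_eq0 // factr_neq0.
Qed.

(** * The Cauchy-Kowalevski series of the Gaussian *)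

Local Open Scope classical_set_scope.

Let g y : clif := expR (- rnorm y ^+ 2) *: P y.
Let e y : R := expR (- nsq y).
Notation TT := (iter N (@pexpd R)).

(** The steps alternate between [pexpd_even_pol] and [iter_pexpd_odd_pol]; their scalars build up
    the factorials by which the Cauchy-Kowalevski series divides. *)
Lemma iter_Dirac_gauss n :
  (forall y, iter n.*2 (@Dirac R m) g y =
     (n.*2`!%:R * (e y * (TT (even_pol R n)).[nsq y])) *: P y) /\
  (forall y, iter n.*2.+1 (@Dirac R m) g y =
     (- n.*2.+1`!%:R * (e y * (TT (odd_pol R n)).[nsq y])) *: xmul y (P y)).
Proof.
have TS p : pexpd (TT p) = TT (pexpd p) by rewrite -iterS iterSr.
have even_odd i : (forall y, iter i.*2 (@Dirac R m) g y =
     (i.*2`!%:R * (e y * (TT (even_pol R i)).[nsq y])) *: P y) ->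
   (forall y, iter i.*2.+1 (@Dirac R m) g y =
     (- i.*2.+1`!%:R * (e y * (TT (odd_pol R i)).[nsq y])) *: xmul y (P y)).
  move=> /funext h y; rewrite iterS h.
  have d := is_derive1Z i.*2`!%:R (pexpd_gauss_derive (TT (even_pol R i)) (nsq y)).
  rewrite (Dirac_radial P_homog P_monogenic d) TS pexpd_even_pol iter_pexpdZ.
  rewrite hornerZ factS natrM -[i.*2.+1%:R]natr1 dbl_natr /e; congr (_ *: _).
  by field.
have odd_even i : (forall y, iter i.*2.+1 (@Dirac R m) g y =
     (- i.*2.+1`!%:R * (e y * (TT (odd_pol R i)).[nsq y])) *: xmul y (P y)) ->
   (forall y, iter i.+1.*2 (@Dirac R m) g y =
     (i.+1.*2`!%:R * (e y * (TT (even_pol R i.+1)).[nsq y])) *: P y).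
  move=> /funext h y; rewrite doubleS iterS h.
  have d := is_derive1Z (- i.*2.+1`!%:R)
    (pexpd_gauss_derive (TT (odd_pol R i)) (nsq y)).
  rewrite (Dirac_radial_xmul P_homog P_monogenic d) N_def; congr (_ *: _).
  have := congr1 (horner^~ (nsq y)) (iter_pexpd_odd_pol R N i).
  rewrite /= hornerD hornerN !hornerZ hornerM hornerX => E.
  rewrite [(i.*2.+2)`!]factS natrM (_ : i.*2.+2%:R = 2 * i.+1%:R :> R); last first.
    by rewrite -doubleS dbl_natr.
  transitivity (i.*2.+1`!%:R * (e y * (2 * i.+1%:R * (TT (even_pol R i.+1)).[nsq y]))).
    by rewrite -E /e; ring.
  by ring.
elim: n => [|n [_ IHo]].
  suff h0 y : iter 0.*2 (@Dirac R m) g y =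
     (0.*2`!%:R * (e y * (TT (even_pol R 0)).[nsq y])) *: P y.
    by split => //; exact: even_odd.
  (* [pexpd] fixes the constant 1, so the Gaussian itself has the required form for every [N]. *)
  have -> : TT (even_pol R 0) = even_pol R 0.
    by elim: (N) => //= i ->; exact: pexpd_even_pol0.
  by rewrite even_pol0 hornerC mulr1 mul1r /e -sqr_rnorm.
by split; [exact: odd_even|exact/even_odd/odd_even].
Qed.

(** Among the first [K] terms, [uphalf K] have even index and [K./2] odd index. The sign of
    [(- x0) ^+ i] for odd [i] cancels that of the odd Dirac iterates. *)
Lemma ck_psum_gauss (x0 : R) x K A : ck_psum g x0 x K A =
  e x * P x A * series (fun n => x0 ^+ n.*2 * (TT (even_pol R n)).[nsq x]) (uphalf K)
  + e x * xmul x (P x) A *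
    series (fun n => x0 ^+ n.*2.+1 * (TT (odd_pol R n)).[nsq x]) K./2.
Proof.
elim: K => [|K IH].
  by rewrite /ck_psum big_ord0 ffunE /series /= !big_geq // !mulr0 addr0.
rewrite /ck_psum big_ord_recr /= cadd_app -/(ck_psum g x0 x K) IH cscale_app.
have [IHe IHo] := iter_Dirac_gauss K./2.
have [oK|eK] := boolP (odd K).
  have term i : i = K./2.*2.+1 -> (- x0) ^+ i / i`!%:R * iter i (@Dirac R m) g x A =
      e x * xmul x (P x) A * (x0 ^+ K./2.*2.+1 * (TT (odd_pol R K./2)).[nsq x]).
    move=> ->; rewrite IHo cscale_app !exprS -mul2n !exprM sqrrN.
    by field; rewrite factr_neq0.
  rewrite term; last by rewrite -[LHS]odd_double_half oK add1n.
  by rewrite uphalf_half oK add1n [X in _ = _ + _ * X]seriesSr mulrDr addrA.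
have term i : i = K./2.*2 -> (- x0) ^+ i / i`!%:R * iter i (@Dirac R m) g x A =
    e x * P x A * (x0 ^+ K./2.*2 * (TT (even_pol R K./2)).[nsq x]).
  move=> ->; rewrite IHe cscale_app -mul2n !exprM sqrrN.
  by field; rewrite factr_neq0.
rewrite term; last by rewrite -[LHS]odd_double_half (negbTE eK) add0n.
by rewrite uphalf_half (negbTE eK) add0n [X in _ = _ * X + _]seriesSr mulrDr addrAC.
Qed.

Lemma CK_gauss (x0 : R) x : x != 0 -> CK_at g x0 x (albe_field N x0 x).
Proof.
move=> xn0 A; have s0 : 0 < nsq x by rewrite nsq_gt0.
have [ha hb] := cvg_series_pol N x0 s0.
under eq_fun do rewrite ck_psum_gauss.
have ee : e x * expR (nsq x) = 1 by rewrite /e -expRD addNr expR0.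
have -> : albe_field N x0 x A = e x * P x A * (expR (nsq x) * al N x0 (nsq x))
    + e x * xmul x (P x) A * (expR (nsq x) * be N x0 (nsq x)).
  rewrite /albe_field cadd_app !cscale_app -[LHS]mul1r -ee; ring.
apply: cvgD; apply: cvgMl_tmp.
  exact: cvg_comp (@cvg_uphalf) ha.
exact: cvg_comp (@cvg_half) hb.
Qed.

End Fueter.
End RadialLaplacian.

(** * Assembly of the two equalities *)

Theorem theorem1 (R : realType) (m k : nat) (P : vec R m -> clif R m) :
  odd m ->
  (forall A, homog_poly k (fun y => P y A)) ->
  (forall y, Dirac P y = 0) ->
  forall (x0 : R) (x : vec R m), x != 0 ->
  let N := (k + (m.-1)./2)%N in
  let r := rnorm x in
  let closed : clif R m :=
    expR (x0 ^+ 2 - r ^+ 2) *: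
      cmul ((\sum_(j < N.+1) ('C(N, j))%:R * (-2) ^- j
               * D_r j (fun s => cos (2 * x0 * s)) r) *: cone1 R m
            + (\sum_(j < N.+1) ('C(N, j))%:R * (-2) ^- j
               * D_up j (fun s => sin (2 * x0 * s)) r) *: comega x)
           (P x) in
  CK_at (fun y => expR (- rnorm y ^+ 2) *: P y) x0 x closed /\
  ((-2) ^+ N * (dfact (2 * k + m - 1))%:R)^-1 *:
     Fueter k (fun a b => expR (a ^+ 2 - b ^+ 2) * cos (2 * a * b))
              (fun a b => expR (a ^+ 2 - b ^+ 2) * sin (2 * a * b)) P x0 x
   = closed.
Proof.
move=> m_odd P_homog P_monogenic x0 x xn0 N r closed.
have N_def : (m + 2 * k = 2 * N + 1)%N.
  rewrite /N mulnDr addnC -addnA; congr (_ + _)%N.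
  have odd_half n : odd n -> (n = 2 * n.-1./2 + 1)%N.
    by case: n => // n /=; rewrite addn1 mul2n => /even_halfK ->.
  exact: odd_half.
have r0 : 0 < r by rewrite sqrtr_gt0 -/(nsq x) nsq_gt0.
(* The factor [r] from [closed_odd] absorbs the division by [r] in [comega]; both claims then
   concern the same field. *)
have -> : closed = albe_field P N x0 x.
  rewrite /closed cmul_comega scalerDr !scalerA [_ * (_ / _)]mulrA.
  rewrite closed_even // closed_odd // [r * _]mulrC mulfK ?gt_eqF //.
  by rewrite sqr_rnorm.
split; first exact: CK_gauss.
exact: Fueter_albe.
Qed.
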